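(* Let $d\ge1$, $\alpha\in\mathbb{R}$ and $0<\delta<1$ be fixed. Let $\Sigma_{\alpha,\delta}$ be the set of all generalized solutions $U=(\tau,v,\eta,\zeta)$ of the augmented system $$\partial_t\tau+v\,\partial_s\tau=\tau\,\partial_sv,\quad \partial_tv+v\,\partial_sv=\tau\,\partial_s\tau,\quad \partial_t\eta+v\,\partial_s\eta=-\tau\,\partial_s\zeta,\quad \partial_t\zeta+v\,\partial_s\zeta=-\tau\,\partial_s\eta$$ that are valued in $M\cap G_{\alpha,\delta}$, where $$G_{\alpha,\delta}=\Big\{(\tau,v,\eta,\zeta)\in\mathbb{R}^{1+1+d+d}:\ \delta\le\tau+(v-\alpha)\le\tfrac1\delta\ \text{ and }\ \delta\le\tau-(v-\alpha)\le\tfrac1\delta\Big\},$$ $$M=\big\{(\tau,v,\eta,\zeta)\in\mathbb{R}^{1+1+d+d}:\ \tau v=\eta\cdot\zeta,\ \ \tau^2+v^2+|\eta|^2+|\zeta|^2=1\big\}.$$ Then $\Sigma_{\alpha,\delta}$ is relatively compact for the topology of $C^0(\mathbb{R};L^\infty_{weak^*}(\mathbb{R};\mathbb{R}^{1+1+d+d}))$ induced by the map $$T:(\tau,v,\eta,\zeta)\mapsto(h,q,Y,Z)=\frac1\tau(1,v,\eta,\zeta),$$ and its closure for this topology is the set of all generalized solutions of the augmented system valued in $CM\cap G_{\alpha,\delta}$, where $$CM=\big\{(\tau,v,\eta,\zeta)\in\mathbb{R}^{1+1+d+d}:\ \tau^2+v^2+|\eta|^2+|\zeta|^2+2\,|\tau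 v-\eta\cdot\zeta|\le1\big\}.$$
   Context: Here $\tau,v$ are real valued and $\eta,\zeta$ are $\mathbb{R}^d$-valued functions of $(t,s)\in\mathbb{R}\times\mathbb{R}$; the dot and $|\cdot|$ are the Euclidean inner product and norm. ''Valued in'' a set means: for every $t$, $U(t,s)$ is in the set for almost every $s$. Note that $\delta\le\tau\le1/\delta$ on $G_{\alpha,\delta}$. Generalized solutions. Let $U_0=(\tau_0,v_0,\eta_0,\zeta_0):\mathbb{R}\to\mathbb{R}^{1+1+d+d}$ be Lebesgue measurable and valued in $G_{\alpha,\delta}$. Let $y\mapsto\xi(0,y)$ be the bi-Lipschitz homeomorphism of $\mathbb{R}$ with $\xi(0,0)=0$ and $\partial_y\xi(0,y)=\tau_0(\xi(0,y))$ for a.e. $y$ (that is, $\int_0^{\xi(0,y)}ds/\tau_0(s)=y$). Let $\xi:\mathbb{R}^2\to\mathbb{R}$ be the Lipschitz function, extending $\xi(0,\cdot)$, determined by $$(\partial_t\xi\pm\partial_y\xi)(t,y)=(v_0\pm\tau_0)(\xi(0,y\pm t))$$ (for both choices of sign). Then, for each $t$, $\xi(t,\cdot)$ is a bi-Lipschitz homeomorphism of $\mathbb{R}$. The generalized solution of the augmented system with initial condition $U_0$ is the function $U=(\tau,v,\eta,\zeta)$ on $\mathbb{R}\times\mathbb{R}$ (with $U(t,\cdot)$ defined a.e. for each $t\in\mathbb{R}$) given by $$(v\pm\tau)(t,\xi(t,y))=(v_0\pm\tau_0)(\xi(0,y\pm t)),\qquad(\eta\mp\zeta)(t,\xi(t,y))=(\eta_0\mp\zeta_0)(\xi(0,y\pm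 t)),$$ with upper signs taken together and lower signs taken together. Only generalized solutions obtained in this way from initial data valued in $G_{\alpha,\delta}$ are considered. Topology. $C^0(\mathbb{R};L^\infty_{weak^*}(\mathbb{R};\mathbb{R}^{1+1+d+d}))$ is the space of functions $t\in\mathbb{R}\mapsto u(t,\cdot)\in L^\infty(\mathbb{R};\mathbb{R}^{1+1+d+d})$ that are continuous for the weak-* topology of $L^\infty$ as the dual of $L^1$. Convergence $u_n\to u$ means that, for every $g\in L^1(\mathbb{R})$, $\int_{\mathbb{R}}(u_n-u)(t,s)g(s)\,ds\to0$ uniformly in $t$ on every compact subset of $\mathbb{R}$. In the topology induced by $T$, $U_n\to U$ (all with $\tau>0$) means $TU_n\to TU$ in this space. The map $T$ is one-to-one on $\{\tau>0\}$. Thus the theorem says that the closure of $T(\Sigma_{\alpha,\delta})$ in this space is compact and equals the image under $T$ of the set of generalized solutions valued in $CM\cap G_{\alpha,\delta}$. *)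

(* Defs.v *)
From HB Require Import structures.
From mathcomp Require Import all_boot all_order all_algebra.
From mathcomp Require Import all_classical all_reals all_analysis.

Set Implicit Arguments.
Unset Strict Implicit.
Unset Printing Implicit Defensive.

Import Order.TTheory GRing.Theory Num.Theory.
Import numFieldNormedType.Exports.

Local Open Scope classical_set_scope.
Local Open Scope ring_scope.

Definition dot (R : realType) (d : nat) (x y : 'rV[R]_d) : R :=
  \sum_(i < d) x 0 i * y 0 i.

(* The Euclidean norm; the library norm on ['rV[R]_d] is the sup norm. *)
Definition enorm (R : realType) (d : nat) (x : 'rV[R]_d) : R :=
  Num.sqrt (dot x x).

(* A point (tau, v, eta, zeta) of R^(1+1+d+d), or its image (h, q, Y, Z). *)
Definition state (R : realType) (d : nat) : Type := 'rV[R]_(1 + 1 + d + d).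

Definition mk_state (R : realType) (d : nat) (a b : R) (x y : 'rV[R]_d) :
    state R d :=
  row_mx (row_mx (row_mx a%:M b%:M) x) y.

Section components.
Context (R : realType) (d : nat).
Implicit Type U : state R d.

Definition tau U : R := lsubmx (lsubmx (lsubmx U)) 0 0.
Definition vel U : R := rsubmx (lsubmx (lsubmx U)) 0 0.
Definition eta U : 'rV[R]_d := rsubmx (lsubmx U).
Definition zeta U : 'rV[R]_d := rsubmx U.

End components.

Definition G (R : realType) (d : nat) (alpha delta : R) : set (state R d) :=
  [set U | delta <= tau U + (vel U - alpha) <= delta^-1 /\
           delta <= tau U - (vel U - alpha) <= delta^-1].

Definition M (R : realType) (d : nat) : set (state R d) :=
  [set U | tau U * vel U = dot (eta U) (zeta U) /\
           tau U ^+ 2 + vel U ^+ 2 + enorm (eta U) ^+ 2 + enorm (zeta U) ^+ 2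
             = 1].

Definition CM (R : realType) (d : nat) : set (state R d) :=
  [set U | tau U ^+ 2 + vel U ^+ 2 + enorm (eta U) ^+ 2 + enorm (zeta U) ^+ 2
             + 2 * `|tau U * vel U - dot (eta U) (zeta U)| <= 1].

Arguments M : clear implicits.
Arguments CM : clear implicits.

Definition T (R : realType) (d : nat) (U : state R d) : state R d :=
  (tau U)^-1 *: mk_state 1 (vel U) (eta U) (zeta U).

(* The canonical sigma-algebra on [R] is the Borel one; this is measurability
   for its completion, the sigma-algebra of Lebesgue measurable sets. *)
Definition Lebesgue_measurable_fun (R : realType) (f : R -> R) : Prop :=
  @measurable_fun _ _
    (caratheodory_type (@wlength R idfun)^*%mu) R
    setT f.

Definition bilipschitz_homeo (R : realType) (f : R -> R) : Prop :=
  exists g : R -> R, [/\ cancel f g, cancel g f, lipschitz f & lipschitz g].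

(* [xi t y] is xi(t, y), for the initial condition [U0]. *)
Definition is_flow (R : realType) (d : nat) (U0 : R -> state R d)
    (xi : R -> R -> R) : Prop :=
  [/\ bilipschitz_homeo (xi 0),
      xi 0 0 = 0,
      \forall y \ae (@lebesgue_measure R),
        is_derive (y : R^o) 1 (xi 0 : R^o -> R^o) (tau (U0 (xi 0 y))),
      lipschitz (fun p : R * R => xi p.1 p.2) &
      \forall p \ae (@lebesgue_measure R \x @lebesgue_measure R)%E,
        exists xt xy : R,
          [/\ is_derive (p.1 : R^o) 1 (xi ^~ p.2 : R^o -> R^o) xt,
              is_derive (p.2 : R^o) 1 (xi p.1 : R^o -> R^o) xy,
              xt + xy = vel (U0 (xi 0 (p.2 + p.1)))
                        + tau (U0 (xi 0 (p.2 + p.1))) &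
              xt - xy = vel (U0 (xi 0 (p.2 - p.1)))
                        - tau (U0 (xi 0 (p.2 - p.1)))]].

(* The defining relations are required for every [t] and almost every [y],
   so that [U t] is only constrained up to a null set of positions. *)
Definition is_generalized_solution_from (R : realType) (d : nat)
    (U0 : R -> state R d) (U : R -> R -> state R d) : Prop :=
  exists2 xi : R -> R -> R, is_flow U0 xi &
    forall t : R, \forall y \ae (@lebesgue_measure R),
      let W := U t (xi t y) in
      let Wp := U0 (xi 0 (y + t)) in
      let Wm := U0 (xi 0 (y - t)) in
      [/\ vel W + tau W = vel Wp + tau Wp,
          vel W - tau W = vel Wm - tau Wm,
          eta W - zeta W = eta Wp - zeta Wp &
          eta W + zeta W = eta Wm + zeta Wm].

Definition generalized_solution (R : realType) (d : nat) (alpha delta : R)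
    (U : R -> R -> state R d) : Prop :=
  exists U0 : R -> state R d,
    [/\ forall i, Lebesgue_measurable_fun (fun s => U0 s 0 i),
        \forall s \ae (@lebesgue_measure R), G alpha delta (U0 s) &
        is_generalized_solution_from U0 U].

Definition valued_in (R : realType) (d : nat) (A : set (state R d))
    (U : R -> R -> state R d) : Prop :=
  forall t : R, \forall s \ae (@lebesgue_measure R), A (U t s).

Definition solutions_in (R : realType) (d : nat) (alpha delta : R)
    (A : set (state R d)) : set (R -> R -> state R d) :=
  [set U | generalized_solution alpha delta U /\
           valued_in (A `&` G alpha delta) U].

Definition Sigma (R : realType) (d : nat) (alpha delta : R) :
    set (R -> R -> state R d) :=
  solutions_in alpha delta (M R d).

Arguments Sigma : clear implicits.

Section weak_star.
Context (R : realType).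

Definition Linfty : Type :=
  LspaceType (@lebesgue_measure R) (leey 1 : (1 <= +oo)%E).

HB.instance Definition _ := gen_eqMixin Linfty.
HB.instance Definition _ := gen_choiceMixin Linfty.

Definition L1 : Type := LfunType (@lebesgue_measure R) (lexx 1%E).

Definition Linfty_vec (n : nat) : Type := 'I_n -> Linfty.
HB.instance Definition _ n := Choice.on (Linfty_vec n).

(* The weak-* topology (and uniformity) is the initial one for the family of
   all pairings with elements of L^1. *)
Definition pairing (n : nat) (u : Linfty_vec n) : {ptws 'I_n * L1 -> R} :=
  fun ig => \int[@lebesgue_measure R]_s (u ig.1 s * ig.2 s).

Definition Linfty_weakstar (n : nat) : Type :=
  initial_topology (@pairing n).
HB.instance Definition _ n := Uniform.on (Linfty_weakstar n).

(* C^0(R; L^oo_weak-*(R; R^n)), with the topology of uniform convergence on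
   compact sets of times. *)
Definition C0_weakstar (n : nat) : Type :=
  initial_topology (id : continuousType R (Linfty_weakstar n) ->
                         {family compact, R -> Linfty_weakstar n}).
HB.instance Definition _ n := Uniform.on (C0_weakstar n).

End weak_star.

(* [u] is the element of C^0(R; L^oo_weak-*(R; R^(1+1+d+d))) given by the
   function [W] of (t, s). *)
Definition represents (R : realType) (d : nat)
    (u : C0_weakstar R (1 + 1 + d + d)) (W : R -> R -> state R d) : Prop :=
  forall (t : R) (i : 'I_(1 + 1 + d + d)),
    \forall s \ae (@lebesgue_measure R),
      (u : continuousType R (Linfty_weakstar R (1 + 1 + d + d))) t i s
        = W t s 0 i.

(* The topology induced by T is handled through images under T: the closure and
   compactness of a set of solutions are those of its image in [C0_weakstar]. *)
Definition T_image (R : realType) (d : nat)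
    (S : set (R -> R -> state R d)) : set (C0_weakstar R (1 + 1 + d + d)) :=
  [set u | exists2 U, S U & represents u (fun t s => T (U t s))].

(* Main.v *)
(* In the Lagrangian variable y, the characteristic coordinates (tau +- v,
   eta -+ zeta) of a solution are functions of y + t and of y - t. Their primitives
   W(c, o, .) determine the solution, and turn the constraints into conditions on
   pairs of values: membership in G bounds the slopes of W(c, 0, .), while CM says
   that each of the two vectors (tau + v, eta - zeta), (tau - v, eta + zeta) has norm
   at most 1 (M: equal to 1), that is, that W(c, ., .) is 1-Lipschitz for the Euclidean
   norm. Data with values in CM thus form a closed subset of a product of
   segments, which is compact by Tychonoff's theorem.
   At time t, the primitives in s of 1/tau, v/tau, eta/tau, zeta/tau are combinations
   of values of W composed with the inverse of the flow
   y |-> (W(+, 0, y + t) + W(-, 0, y - t)) / 2, so they depend continuously on (t, W).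
   By density of step functions in L^1, the map from data to C^0(R; L^oo weak-star) is
   continuous. Its image is compact, hence closed. Finally a relaxed datum is a
   limit of data on the unit sphere: one coordinate among eta -+ zeta is replaced
   by rapid zigzags of the right slope. *)

From HB Require Import structures.
Require Import Defs.
From mathcomp Require Import all_boot all_order all_algebra finmap.
From mathcomp Require Import all_classical all_reals all_analysis.
From mathcomp Require Import measurable_realfun ess_sup_inf lra ring.

Import Order.TTheory GRing.Theory Num.Theory.
Import numFieldNormedType.Exports.
Local Open Scope classical_set_scope.
Local Open Scope ring_scope.
Set Implicit Arguments.
Unset Strict Implicit.
Unset Printing Implicit Defensive.

(** Weak star convergence commutes neither with products, nor with division by [tau], nor with
    composition with the flow, so limits cannot be taken in the unknowns themselves. [T] removes
    this obstacle: if F has derivative l in the label y, then F composed with the inverse flow has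
    derivative l / tau in the position. The components of T U are thus derivatives of functions that
    are stable under pointwise limits of the data, and bounded densities converge weak star once
    their primitives converge pointwise. Passing between constraints on almost every derivative and
    constraints on all increments requires Rademacher's theorem and the fundamental theorem of
    calculus for Lipschitz functions. Both are drawn from Radon-Nikodym: a large linear term makes a
    Lipschitz function bi-Lipschitz, and Lebesgue measure transported by its inverse is absolutely
    continuous. [M] relaxes to [CM] because weak limits of unit vectors have norm at most 1; [G]
    bears on one coordinate only of each characteristic vector, and d >= 1 leaves another one free
    to oscillate. *)

Section slopes.
Context {R : realType}.
Implicit Types (f g F G : R -> R) (m L : R).
Local Notation mu := (@lebesgue_measure R).

(** One predicate covers Lipschitz functions ([m = - L]), nondecreasing ones ([m = 0]) and
    increasing bi-Lipschitz ones ([0 < m]), and it passes to pointwise limits. *)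
Definition slopes m L F :=
  forall x y, x <= y -> m * (y - x) <= F y - F x <= L * (y - x).

Lemma slopes_continuous m L F : slopes m L F -> continuous F.
Proof.
move=> sF; pose K := `|m| + `|L| + 1.
have K0 : 0 < K by rewrite /K; have := normr_ge0 m; have := normr_ge0 L; lra.
have FK x y : `|F x - F y| <= K * `|x - y|.
  wlog xy : x y / y <= x => [H|].
    by have [/H//|/ltW/H] := leP y x; rewrite distrC (distrC y).
  have /andP[h1 h2] := sF _ _ xy.
  rewrite (ger0_norm (_ : 0 <= x - y)) ?subr_ge0// ler_norml.
  have xy0 : 0 <= x - y by rewrite subr_ge0.
  have := ler_wpM2r xy0 (ler_norm L); have := ler_wpM2r xy0 (lerNnormlW (lexx `|m|)).
  have := ler_wpM2r xy0 (normr_ge0 m); have := ler_wpM2r xy0 (normr_ge0 L).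
  by rewrite /K; lra.
move=> x; apply/cvgrPdist_lt => e e0.
near=> y; apply: le_lt_trans (FK _ _) _.
rewrite mulrC -ltr_pdivlMr//; near: y.
apply: cvgr_dist_lt; last exact: divr_gt0.
exact: cvg_id.
Unshelve. all: end_near. Qed.

Lemma slopes_measurable m L F : slopes m L F -> measurable_fun setT F.
Proof. by move=> /slopes_continuous; exact: continuous_measurable_fun. Qed.

Lemma slopes_le m L m' L' F : m' <= m -> L <= L' -> slopes m L F ->
  slopes m' L' F.
Proof.
move=> mm LL sF x y xy; have /andP[h1 h2] := sF _ _ xy.
have xy0 : 0 <= y - x by rewrite subr_ge0.
by rewrite (le_trans _ h1) ?ler_wpM2r// (le_trans h2)// ler_wpM2r.
Qed.

Lemma slopes_lip L F : slopes (- L) L F ->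
  forall x y, `|F x - F y| <= L * `|x - y|.
Proof.
move=> sF x y; wlog xy : x y / y <= x => [H|].
  by have [/H//|/ltW/H] := leP y x; rewrite distrC (distrC y).
rewrite ler_norml (ger0_norm (_ : 0 <= x - y)) ?subr_ge0// -mulNr.
exact: sF.
Qed.

Lemma slopesD m L m' L' F G : slopes m L F -> slopes m' L' G ->
  slopes (m + m') (L + L') (fun x => F x + G x).
Proof.
by move=> sF sG x y xy; have := sF _ _ xy; have := sG _ _ xy; lra.
Qed.

Lemma slopes_inverse m L G : 0 < m -> slopes m L G ->
  exists g, [/\ cancel G g, cancel g G & slopes L^-1 m^-1 g].
Proof.
move=> m0 sG.
have L0 : 0 < L.
  by have := sG 0 1 ler01; rewrite subr0 !mulr1 => /andP[]; lra.
have surj v : exists c, G c = v.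
  (* Slope at least [m] carries [G] from [G 0] past [v] within distance [r], so the intermediate
     value theorem applies on [-r, r]. *)
  pose r := `|v - G 0| / m; have r0 : 0 <= r by rewrite divr_ge0// ltW.
  have mr : m * r = `|v - G 0| by rewrite /r mulrC divfK// gt_eqF.
  have := sG 0 r r0; have := sG (- r) 0; rewrite oppr_le0 => /(_ r0).
  rewrite !subr0 sub0r opprK mr => /andP[h1 _] /andP[h2 _].
  have rr : - r <= r by lra.
  have [||c _ <-] := @IVT R G (- r) r v rr; last by exists c.
  - exact/continuous_subspaceT/slopes_continuous/sG.
  - rewrite ge_min le_max; move: h1 h2; have := ler_norm (v - G 0).
    have := lerNnormlW (lexx `|v - G 0|).
    by move=> *; apply/andP; split; apply/orP; [left|right]; lra.
have [g Gg] := choice surj.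
have sg : slopes L^-1 m^-1 g.
  move=> s s' ss'; have gg : g s <= g s'.
    rewrite leNgt; apply/negP => gg; have /andP[h _] := sG _ _ (ltW gg).
    have : 0 < m * (g s - g s') by rewrite mulr_gt0// subr_gt0.
    by rewrite !Gg in h; lra.
  have /andP[] := sG _ _ gg; rewrite !Gg => h1 h2.
  by rewrite ler_pdivrMl// h2 ler_pdivlMl.
exists g; split => // x.
have gGx := Gg (G x); apply/eqP; rewrite eq_le; apply/andP; split; rewrite leNgt;
  apply/negP => /[dup] h /ltW /sG /andP[+ _]; rewrite gGx subrr;
  by rewrite leNgt mulr_gt0// subr_gt0.
Qed.

(** Lebesgue measure is an infimum over countable covers by half-open intervals, and [nu] is
    countably subadditive on such covers. *)
Lemma measure_le_lebesgue (nu : {measure set (measurableTypeR R) -> \bar R}) L :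
  0 < L -> (forall a b, a <= b -> (nu `]a, b]%classic <= (L * (b - a))%:E)%E) ->
  forall A, measurable A -> (nu A <= L%:E * mu A)%E.
Proof.
move=> L0 nuL A mA.
rewrite muleC -lee_pdivrMr//.
rewrite /lebesgue_measure /= /lebesgue_stieltjes_measure /measure_extension /=.
apply: le_ereal_inf_tmp => _ [F [Fo AF] <-].
rewrite lee_pdivrMr// muleC -nneseriesZl; last first.
  by move=> k _; exact: wlength_ge0.
have mF k : measurable (F k : set (measurableTypeR R)).
  by have [x _ <-] := Fo k; exact: measurable_itv.
apply: (@le_trans _ _ (\sum_(k <oo) nu (F k))%E).
  exact: measure_sigma_subadditive.
apply: lee_nneseries => k _ //.
have /ocitvP[->|[x /ltW xy ->]] := Fo k; first by rewrite measure0 wlength0 mule0.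
by rewrite wlength_itv_bnd//; exact: nuL.
Qed.

(** The preimage of a set by [f] is contained in its image by the Lipschitz left inverse [g], and
    Lipschitz images of null sets are null. Quantitatively, the pushforward of [mu] by [f] is at
    most [K] times [mu]. *)
Lemma preimage_negligible f g L : measurable_fun setT f -> cancel f g ->
  (forall x y, `|g x - g y| <= L * `|x - y|) ->
  forall N, mu.-negligible N -> mu.-negligible (f @^-1` N).
Proof.
move=> mf fg gL N [B [mB B0 NB]].
have mfB : measurable (f @^-1` B) by rewrite -[X in measurable X]setTI; exact: mf.
exists (f @^-1` B); split => //; last exact: preimage_subset.
apply/eqP; rewrite eq_le measure_ge0 andbT.
(* The preimage of ]a, b] lies in an interval centred at [g a] of radius [K / 2 * (b - a)], hence
   the factor 2; adding 1 makes [K] positive even if [L] is 0. *)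
pose K := 2 * (`|L| + 1); have K0 : 0 < K by rewrite /K; have := normr_ge0 L; lra.
have := @measure_le_lebesgue (pushforward mu (f : measurableTypeR R -> measurableTypeR R)) K K0 _ B mB.
rewrite /pushforward B0 mule0; apply => a b ab.
have ab0 : 0 <= b - a by lra.
apply: (@le_trans _ _ (mu `[g a - K / 2 * (b - a), g a + K / 2 * (b - a)]%classic)).
  change (mu (f @^-1` `]a, b]%classic) <=
    mu `[(g a - K / 2 * (b - a))%R, (g a + K / 2 * (b - a))%R]%classic)%E.
  apply: (@le_measure _ _ _ mu); rewrite ?inE.
  - by rewrite -[X in measurable X]setTI; apply: mf => //; exact: measurable_itv.
  - exact: measurable_itv.
  move=> x /=; rewrite !in_itv /= => /andP[h1 h2].
  rewrite -ler_distlC; have := gL (f x) a; rewrite fg distrC => /le_trans; apply.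
  rewrite gtr0_norm ?subr_gt0//; apply: (@le_trans _ _ (K / 2 * (f x - a))).
    by rewrite ler_wpM2r ?subr_ge0 ?(ltW h1)// /K; have := ler_norm L; lra.
  by rewrite ler_wpM2l ?lerB// divr_ge0// ltW.
have := ltW K0; rewrite lebesgue_measure_itv /= lte_fin => K0'.
case: ifPn => _; last by rewrite lee_fin mulr_ge0.
by rewrite -EFinD lee_fin; lra.
Qed.

Lemma ae_preimage f g L : measurable_fun setT f -> cancel f g ->
  (forall x y, `|g x - g y| <= L * `|x - y|) ->
  forall P : R -> Prop, (\forall s \ae mu, P s) -> \forall y \ae mu, P (f y).
Proof. by move=> mf fg gL P; exact: preimage_negligible. Qed.

End slopes.

(** * Lipschitz functions and their densities *)

Section image_measure.
Context {R : realType}.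
Local Notation mu := (@lebesgue_measure R).
Variables (g : R -> R) (D : set (measurableTypeR R)).
Hypotheses (mg : measurable_fun setT g) (mD : measurable D)
  (muD : (mu D < +oo)%E).

(** The proofs are carried as arguments so that the measure structures declared below can be
    inferred from the term. *)
Definition image_measure (_ : measurable_fun setT g) (_ : measurable D)
    (_ : (mu D < +oo)%E) : set (measurableTypeR R) -> \bar R :=
  fun A => mu (g @^-1` A `&` D).
Local Notation nu := (image_measure mg mD muD).

Let mgD (A : set (measurableTypeR R)) :
  measurable A -> measurable (g @^-1` A `&` D : set (measurableTypeR R)).
Proof.
move=> mA; apply: measurableI => //.
by rewrite -[X in measurable X]setTI; exact: mg.
Qed.

Let nu0 : nu set0 = 0%E.
Proof. by rewrite /image_measure preimage_set0 set0I measure0. Qed.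

Let nu_ge0 A : (0 <= nu A)%E. Proof. exact: measure_ge0. Qed.

Let nu_sigma_additive : semi_sigma_additive nu.
Proof.
move=> F mF tF mUF; rewrite /image_measure preimage_bigcup setI_bigcupl.
apply: measure_semi_sigma_additive.
- by move=> n; exact: mgD.
- apply/trivIsetP => /= i j _ _ ij; rewrite setIACA setIid -preimage_setI.
  by move/trivIsetP : tF => /(_ _ _ _ _ ij) ->//; rewrite preimage_set0 set0I.
- by rewrite -setI_bigcupl -preimage_bigcup; exact: mgD.
Qed.

HB.instance Definition _ := isMeasure.Build _ _ _ nu nu0 nu_ge0 nu_sigma_additive.

Let nu_fin : fin_num_fun nu.
Proof.
move=> U mU; rewrite ge0_fin_numE//; apply: le_lt_trans muD.
rewrite /image_measure; apply: (@le_measure _ _ _ mu); rewrite ?inE//.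
exact: mgD.
Qed.

HB.instance Definition _ := @Measure_isFinite.Build _ _ _ nu nu_fin.

(** Since [h] is a Lipschitz left inverse of [g], preimages by [g] of null sets are null, so the
    image measure is absolutely continuous and Radon-Nikodym applies. *)
Lemma image_measure_density L h : cancel g h ->
  (forall x y, `|h x - h y| <= L * `|x - y|) ->
  exists f : R -> R, [/\ mu.-integrable setT (EFin \o f) &
    forall A, measurable A ->
      mu (g @^-1` A `&` D) = (\int[mu]_(x in A) (f x)%:E)%E].
Proof.
move=> gh hL.
have [|f [f0 ffin fint fE]] :=
  @radon_nikodym_sigma_finite _ (measurableTypeR R) R mu nu.
  apply/null_content_dominatesP => A mA A0.
  apply/eqP; rewrite eq_le measure_ge0 andbT.
  have /(preimage_negligible mg gh hL) : mu.-negligible A by exact/negligibleP.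
  move=> [B [mB B0 AB]]; rewrite -B0.
  apply: (@le_measure _ _ _ mu); rewrite ?inE//; first exact: mgD.
  by move=> x [/AB].
exists (fine \o f); have Ef : EFin \o (fine \o f) = f.
  by apply/funext => x /=; rewrite fineK.
split; [by rewrite Ef|move=> A mA].
transitivity (nu A) => //; rewrite fE//.
by apply: eq_integral => x _; rewrite /= fineK.
Qed.

End image_measure.

(** * Derivatives through sequences of difference quotients *)

Section has_deriv.
Context {R : realType}.
Implicit Types (F G : R -> R) (m L x l : R).

Definition has_deriv F x l : Prop :=
  is_derive (x : R^o) 1 (F : R^o -> R^o) l.

Lemma has_deriv_unique F x l l' : has_deriv F x l -> has_deriv F x l' -> l = l'.
Proof. by move=> [_ <-] [_ <-]. Qed.

Lemma has_deriv_near F G x l : (\forall y \near x, F y = G y) ->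
  has_deriv F x l -> has_deriv G x l.
Proof. exact: (@near_eq_is_derive R R^o R^o). Qed.

Lemma has_deriv_cst c x : has_deriv (fun=> c) x 0.
Proof. exact: is_derive_cst. Qed.

Lemma has_deriv_id x : has_deriv id x 1.
Proof. exact: is_derive_id. Qed.

Lemma has_derivD F G x l l' : has_deriv F x l -> has_deriv G x l' ->
  has_deriv (fun y => F y + G y) x (l + l').
Proof. by move=> dF dG; exact: (@is_deriveD R R^o R^o). Qed.

Lemma has_derivN F x l : has_deriv F x l -> has_deriv (fun y => - F y) x (- l).
Proof. by move=> dF; exact: (@is_deriveN R R^o R^o). Qed.

Lemma has_derivB F G x l l' : has_deriv F x l -> has_deriv G x l' ->
  has_deriv (fun y => F y - G y) x (l - l').
Proof. by move=> dF dG; apply: has_derivD => //; exact: has_derivN. Qed.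

Lemma has_derivZ F x l c : has_deriv F x l ->
  has_deriv (fun y => c * F y) x (c * l).
Proof. by move=> dF; exact: (@is_deriveZ R R^o R^o). Qed.

Lemma has_deriv_comp F G x l l' : has_deriv F (G x) l -> has_deriv G x l' ->
  has_deriv (F \o G) x (l * l').
Proof. exact: is_derive1_comp. Qed.

(** Steps along a sequence are enough for bounds and measurability; [s = 1] approaches from the
    right and [s = -1] from the left. *)
Lemma has_deriv_seq F x l s : s != 0 -> has_deriv F x l ->
  (s * n.+1%:R) * (F (x + (s * n.+1%:R)^-1) - F x) @[n --> \oo] --> l.
Proof.
move=> s0 [dl dlE]; move: dl; rewrite /derivable => dl.
have {}dl : h^-1 * (F (h + x) - F x) @[h --> 0^'] --> l.
  rewrite -dlE; apply: cvg_trans dl; apply: near_eq_cvg.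
  by near=> h; rewrite /= [h *: 1]mulr1.
have := (cvgr_dnbhsP _ _ _).1 dl (fun n => (s * n.+1%:R)^-1).
have -> : (fun n => (s * n.+1%:R) * (F (x + (s * n.+1%:R)^-1) - F x)) =
    fun n => (s * n.+1%:R)^-1^-1 * (F ((s * n.+1%:R)^-1 + x) - F x).
  by apply/funext => n; rewrite invrK (addrC x).
apply; split => [n|]; first by rewrite invr_eq0 mulf_neq0// pnatr_eq0.
rewrite -(mulr0 s^-1); under eq_fun do rewrite invfM.
by apply: cvgMr; exact: cvg_harmonic.
Unshelve. all: end_near. Qed.

Lemma slopes_has_deriv m L F x l : slopes m L F -> has_deriv F x l -> m <= l <= L.
Proof.
move=> sF /(has_deriv_seq (oner_neq0 R)).
have q n : m <= 1 * n.+1%:R * (F (x + (1 * n.+1%:R)^-1) - F x) <= L.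
  rewrite mul1r; have := sF x (x + n.+1%:R^-1); rewrite lerDl invr_ge0 => /(_ (ler0n _ _)).
  rewrite [x + _ - x]addrAC subrr add0r => /andP[h1 h2].
  by rewrite mulrC -ler_pdivrMr// h1 -ler_pdivlMr.
move=> ql; apply/andP; split; [apply: (cvgr_to_ge ql)|apply: (cvgr_to_le ql)];
  by apply: nearW => n; have /andP[] := q n.
Qed.

(** Fermat's rule at a global minimum: left and right quotients have opposite signs. It serves to
    compare the derivatives of two functions that touch. *)
Lemma has_deriv_min0 F x l : (forall y, 0 <= F y) -> F x = 0 ->
  has_deriv F x l -> l = 0.
Proof.
move=> F0 Fx dF; apply/eqP; rewrite eq_le.
have N10 : (-1 : R) != 0 by rewrite oppr_eq0 oner_neq0.
apply/andP; split; [apply: (cvgr_to_le (has_deriv_seq N10 dF))|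
  apply: (cvgr_to_ge (has_deriv_seq (oner_neq0 R) dF))]; apply: nearW => n.
  by rewrite Fx subr0 mulN1r mulNr oppr_le0 mulr_ge0.
by rewrite Fx subr0 mul1r mulr_ge0.
Qed.

End has_deriv.

Section ae.
Context {R : realType}.
Local Notation mu := (@lebesgue_measure R).
Implicit Types P Q S : R -> Prop.

Lemma aeS P Q : (forall x, P x -> Q x) ->
  (\forall x \ae mu, P x) -> \forall x \ae mu, Q x.
Proof. by move=> PQ; apply: negligibleS => x /= nQ /PQ. Qed.

Lemma aeI P Q : (\forall x \ae mu, P x) -> (\forall x \ae mu, Q x) ->
  \forall x \ae mu, P x /\ Q x.
Proof.
move=> aP aQ; apply: negligibleS (negligibleU aP aQ) => x /=.
by move/not_andP.
Qed.

Lemma aeS2 P Q S : (forall x, P x -> Q x -> S x) ->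
  (\forall x \ae mu, P x) -> (\forall x \ae mu, Q x) -> \forall x \ae mu, S x.
Proof. by move=> PQS aP aQ; apply: aeS (aeI aP aQ) => x []; exact: PQS. Qed.

Lemma ae_exists P a b : (\forall x \ae mu, P x) -> a < b ->
  exists2 x, a < x <= b & P x.
Proof.
move=> [B [mB B0 PB]] ab; apply: contrapT => nP.
have : (mu (`]a, b]%classic : set R) <= mu B)%E.
  apply: (@le_measure _ _ _ mu); rewrite ?inE// => x /=; rewrite in_itv/= => xab.
  by apply: PB => Px; apply: nP; exists x.
by rewrite B0 lebesgue_measure_itv/= lte_fin ab -EFinB lee_fin subr_le0 leNgt ab.
Qed.

Lemma ae_neq (a : R) : \forall x \ae mu, x != a.
Proof.
exists [set a]; split; [exact: measurable_set1|exact: lebesgue_measure_set1|].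
by move=> x /= /negP; rewrite negbK => /eqP.
Qed.

Lemma ae_all_itv P :
  (forall n : nat, \forall x \ae mu, - n%:R < x < n%:R -> P x) ->
  \forall x \ae mu, P x.
Proof.
move=> /(@ae_foralln _ _ _ mu (fun n x => - n%:R < x < n%:R -> P x)).
apply: aeS => x H.
apply: (H (Num.truncn `|x|).+1); rewrite -ltr_norml.
by rewrite truncnS_gt.
Qed.

End ae.

Section clamp.
Context {R : realType}.
Implicit Types m L x : R.

(** Turns a bound known almost everywhere into one valid everywhere, without losing
    measurability. *)
Definition clamp m L x := Num.max m (Num.min L x).

Lemma clamp_in m L x : m <= L -> m <= clamp m L x <= L.
Proof. by move=> mL; rewrite /clamp le_max lexx/= ge_max mL ge_min lexx. Qed.

Lemma clampK m L x : m <= x <= L -> clamp m L x = x.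
Proof. by move=> /andP[mx xL]; rewrite /clamp (min_idPr xL) (max_idPr mx). Qed.

Lemma measurable_clamp m L (f : R -> R) : measurable_fun setT f ->
  measurable_fun setT (fun x => clamp m L (f x)).
Proof. by move=> mf; apply: measurable_maxr => //; exact: measurable_minr. Qed.

End clamp.

(** * Rademacher's theorem and the fundamental theorem of calculus for Lipschitz functions *)

Section FTC.
Context {R : realType}.
Implicit Types (f g F G u : R -> R) (m L : R).
Local Notation mu := (@lebesgue_measure R).

Lemma is_derive_FTC (F u : R -> R) n :
  mu.-integrable `]- n, n]%classic (EFin \o u) ->
  (forall x y, - n <= x -> x <= y -> y <= n ->
     F y - F x = \int[mu]_(t in `]x, y]%classic) u t) ->
  \forall x \ae mu, - n < x < n -> has_deriv F x (u x).
Proof.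
move=> iu FE; pose f := u \_ `]- n, n]%classic.
have mn : measurable (`]- n, n]%classic : set R) by exact: measurable_itv.
have intf : mu.-integrable setT (EFin \o f).
  by rewrite /f -restrict_EFin -integrable_mkcond.
have lf : locally_integrable setT f by apply: open_integrable_locally => //; exact: openT.
have int_f y : mu.-integrable [set` Interval (BRight (- n)) (BRight y)] (EFin \o f).
  exact: integrableS intf.
have := FTC1 int_f lf; apply: aeS => x /= H /andP[nx xn].
have [dF Fx] := H nx.
have fx : f x = u x.
  by rewrite /f patchE mem_set//= in_itv/= nx ltW.
pose F0 x := \int[mu]_(t in [set` Interval (BRight (- n)) (BRight x)]) f t.
have dF0 : has_deriv F0 x (u x).
  by rewrite -fx -Fx derive1E; exact: (@derivableP R R^o R^o).
apply: (@has_deriv_near _ (fun y => F0 y + F (- n))); last first.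
  by have := has_derivD dF0 (has_deriv_cst (F (- n)) x); rewrite addr0.
near=> y; rewrite /F0.
have ny : - n < y by near: y; exact: lt_nbhsr.
have yn : y < n by near: y; exact: lt_nbhsl.
apply/eqP; rewrite eq_sym -subr_eq (FE _ _ (lexx _) (ltW ny) (ltW yn)); apply/eqP.
apply: eq_Rintegral => t; rewrite inE/= in_itv/= => /andP[h1 h2].
by rewrite /f patchE mem_set//= in_itv/= h1 (le_trans h2)// ltW.
Unshelve. all: end_near. Qed.

Lemma integrable_bounded u L a b : measurable_fun setT u ->
  (forall x, `|u x| <= L) -> mu.-integrable `]a, b]%classic (EFin \o u).
Proof.
move=> mf uL; apply: measurable_bounded_integrable => //.
- rewrite /= lebesgue_measure_itv/=.
  by case: ifPn => // _; rewrite -EFinB ltry.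
- exact: measurable_funTS.
- by exists L; split; [exact: num_real|move=> x Lx y _ /=; rewrite (le_trans (uL y))// ltW].
Qed.

Lemma Rintegral_itvoc_cat u L a b c : measurable_fun setT u ->
  (forall x, `|u x| <= L) -> a <= b -> b <= c ->
  \int[mu]_(t in `]a, c]%classic) u t =
  \int[mu]_(t in `]a, b]%classic) u t + \int[mu]_(t in `]b, c]%classic) u t.
Proof.
move=> mu_ uL ab bc.
rewrite -(@Rintegral_itvB _ u (BRight a) (BRight c) b) ?bnd_simp//.
  by rewrite addrC subrK.
exact: integrable_bounded.
Qed.

Lemma primitive_exists u L : measurable_fun setT u -> (forall x, `|u x| <= L) ->
  exists F, [/\ F 0 = 0, slopes (- L) L F,
    forall x y, x <= y -> F y - F x = \int[mu]_(t in `]x, y]%classic) u t &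
    \forall x \ae mu, has_deriv F x (u x)].
Proof.
move=> mf uL.
pose F y := if 0 <= y then \int[mu]_(t in `]0, y]%classic) u t
            else - \int[mu]_(t in `]y, 0]%classic) u t.
have FE x y : x <= y -> F y - F x = \int[mu]_(t in `]x, y]%classic) u t.
  move=> xy; rewrite /F; have [x0|x0] := leP 0 x.
    by rewrite (le_trans x0 xy) (Rintegral_itvoc_cat mf uL x0 xy) addrAC subrr add0r.
  have [y0|y0] := leP 0 y.
    by rewrite (Rintegral_itvoc_cat mf uL (ltW x0) y0) opprK addrC.
  by rewrite (Rintegral_itvoc_cat mf uL xy (ltW y0)) opprK addrC addrK.
exists F; split => //.
- by rewrite /F lexx set_itvoc0 Rintegral_set0.
- move=> x y xy; rewrite FE// mulNr -ler_norml.
  apply: le_trans (le_normr_Rintegral _ _) _ => //; first exact: integrable_bounded.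
  rewrite -(ger0_norm (_ : 0 <= y - x)) ?subr_ge0//.
  apply: (@le_trans _ _ (\int[mu]_(t in `]x, y]%classic) L)).
    apply: le_Rintegral => //.
    + by apply: (@integrable_bounded (fun t => `|u t|) L) => //; [exact: measurableT_comp|move=> t; rewrite normr_id].
    + by apply: (@integrable_bounded (cst L) L) => // t; rewrite ger0_norm// (le_trans _ (uL 0)).
  rewrite Rintegral_cst//= lebesgue_measure_itv/= lte_fin.
  have L0 : 0 <= L by rewrite (le_trans _ (uL 0)).
  by case: ifPn => // _; rewrite ?mulr0 ?mulr_ge0// -EFinB /= ler_wpM2l// ler_norm.
- apply: ae_all_itv => n; apply: is_derive_FTC; first exact: integrable_bounded.
  by move=> x y _ xy _; exact: FE.
Qed.

(** With [K = |L| + 1], the function [G = F + K x] has slopes at least 1, hence a Lipschitz inverse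
    [g]. The image by [g] of Lebesgue measure gives ]x, y] the mass [G y - G x]; its density minus
    [K] is a density for [F]. The restriction to ]G (- n), G n] makes the measure finite. *)
Lemma local_density L F (n : R) : slopes (- L) L F -> 0 <= n ->
  exists2 f, mu.-integrable `]- n, n]%classic (EFin \o f) &
  forall x y, - n <= x -> x <= y -> y <= n ->
     F y - F x = \int[mu]_(t in `]x, y]%classic) f t.
Proof.
move=> sF n0; have [K K1] : exists K, `|L| + 1 = K by eexists.
pose G x := F x + K * x.
have sG : slopes 1 (L + K) G.
  move=> x y /[dup] xy /sF; have : 0 <= y - x by rewrite subr_ge0.
  by move=> xy0; have := ler_wpM2r xy0 (ler_norm L); rewrite /G -K1; lra.
have [g [Gg gG sg]] := slopes_inverse ltr01 sG.
have mg := slopes_measurable sg.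
have hG x y : `|G x - G y| <= (L + K) * `|x - y|.
  apply: slopes_lip; apply: slopes_le sG => //.
  by rewrite lerNl -K1; have := lerNnormlW (lexx `|L|); lra.
pose D : set R := `]G (- n), G n]%classic.
have mD : measurable D by exact: measurable_itv.
have muD : (mu D < +oo)%E.
  by rewrite /D lebesgue_measure_itv/=; case: ifPn => // _; rewrite -EFinB ltry.
have [f [fint fE]] := image_measure_density mg mD muD gG hG.
exists (fun x => f x - K).
  have i1 : mu.-integrable `]- n, n]%classic (EFin \o f) by exact: integrableS fint.
  have i2 : mu.-integrable `]- n, n]%classic (EFin \o cst K).
    by apply: (@integrable_bounded (cst K) `|K|).
  have := @integrableB _ (measurableTypeR R) R mu _ (measurable_itv `]- n, n]) _ _ i1 i2.
  by apply: eq_integrable.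
move=> x y nx xy yn.
have ltG a b : (G a < G b) = (a < b).
  apply/idP/idP => [|ab]; last by have /andP[h _] := sG _ _ (ltW ab); lra.
  by apply: contraTT; rewrite -!leNgt => ba; have /andP[h _] := sG _ _ ba; lra.
have leG a b : (G a <= G b) = (a <= b) by rewrite !leNgt ltG.
rewrite RintegralB//; last 2 first.
- exact: integrableS fint.
- by apply: (@integrable_bounded (cst K) `|K|).
have -> : \int[mu]_(t in `]x, y]%classic) f t = G y - G x.
  rewrite /Rintegral -fE//.
  rewrite (_ : _ `&` _ = `]G x, G y]%classic).
    rewrite lebesgue_measure_itv/= lte_fin; case: ifPn => // xy'.
    move: xy' (sG _ _ xy); rewrite -leNgt => xy' /andP[+ _]; rewrite mul1r => h.
    by rewrite (_ : x = y) ?subrr//; lra.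
  apply/seteqP; split => t /=; have [s ->] : exists s, t = G s by [exists (g t)];
    rewrite !in_itv/= ltG leG Gg.
    by move=> [].
  move=> /andP[xs sy]; rewrite /D /= in_itv/= xs sy ltG leG; split => //.
  by rewrite (le_lt_trans nx xs) (le_trans sy yn).
rewrite Rintegral_cst//= lebesgue_measure_itv/= lte_fin /G.
by case: ifPn => /= xy'; [lra|rewrite (_ : x = y) ?subrr; lra].
Qed.

(** Local densities give differentiability almost everywhere; a single global density is then
    rebuilt from the difference quotients, so that no gluing over intervals is needed. *)
Lemma lipschitz_density L F : slopes (- L) L F ->
  exists u, [/\ measurable_fun setT u, forall x, `|u x| <= L,
    forall x y, x <= y -> F y - F x = \int[mu]_(t in `]x, y]%classic) u t &
    \forall x \ae mu, has_deriv F x (u x)].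
Proof.
move=> sF.
have dF : \forall x \ae mu, exists l, has_deriv F x l.
  apply: ae_all_itv => n; have [f fi fE] := local_density sF (ler0n _ n).
  by apply: aeS (is_derive_FTC fi fE) => x H xn; exists (f x); exact: H.
pose q (n : nat) x := n.+1%:R * (F (x + n.+1%:R^-1) - F x).
have qL n x : `|q n x| <= L.
  rewrite /q normrM normr_nat; have := slopes_lip sF (x + n.+1%:R^-1) x.
  rewrite [X in _ <= _ * `|X - _|]addrC addrK normfV normr_nat => /(ler_wpM2l (ler0n R n.+1)).
  by rewrite mulrCA divff// mulr1.
have mq n : measurable_fun setT (q n).
  apply: measurable_funM => //; apply: measurable_funB.
    apply: measurableT_comp; first exact: slopes_measurable sF.
    exact: measurable_funD.
  exact: slopes_measurable sF.
(* The upper limit of the forward quotients is measurable and equals the derivative wherever there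
   is one; clamping makes the bound [L] hold at every point. *)
pose u x := clamp (- L) L (limn_sup (q ^~ x)).
have ubq x : has_ubound (range (q ^~ x)).
  by exists L => _ [n _ <-]; rewrite (le_trans (ler_norm _)).
have lbq x : has_lbound (range (q ^~ x)).
  by exists (- L) => _ [n _ <-]; have := qL n x; rewrite ler_norml => /andP[].
have mu_ : measurable_fun setT u by apply: measurable_clamp; exact: measurable_fun_limn_sup.
have dFu x l : has_deriv F x l -> l = u x.
  move=> dl; have ql : q ^~ x @ \oo --> l.
    by have := has_deriv_seq (oner_neq0 R) dl; under eq_fun do rewrite mul1r.
  have lL := slopes_has_deriv sF dl.
  by rewrite /u (cvg_limn_inf_sup ql).2 clampK.
have L0 : 0 <= L by rewrite (le_trans _ (qL 0 0)).
have uL x : `|u x| <= L by rewrite ler_norml clamp_in// lerNl (le_trans _ L0)// oppr_le0.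
have dF' : \forall x \ae mu, has_deriv F x (u x).
  by apply: aeS dF => x [l dl]; rewrite -(dFu x l).
exists u; split => // x y xy.
have [n [n0 nx yn]] : exists n, [/\ 0 <= n, - n <= x & y <= n].
  exists (`|x| + `|y|); rewrite addr_ge0//; split => //.
    by have := lerNnormlW (lexx `|x|); have := normr_ge0 y; lra.
  by have := ler_norm y; have := normr_ge0 x; lra.
have [f fi fE] := local_density sF n0.
rewrite fE// /Rintegral; congr fine; apply: ae_eq_integral => //.
- apply: (measurable_int mu); apply: integrableS fi => //.
  by move=> t /=; rewrite !in_itv/= => /andP[xt ty]; rewrite (le_lt_trans nx) ?(le_trans ty).
- by apply/measurable_EFinP; exact: measurable_funTS.
(* [is_derive_FTC] differentiates only strictly between [- n] and [n], while the right end [y] may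
   be equal to [n]. *)
have ne : \forall x \ae mu, x != n.
  exact: ae_neq.
apply: aeS (aeI ne (aeI dF' (is_derive_FTC fi fE))) => t [tn [du df]] /=; rewrite in_itv/= => /andP[xt ty].
congr EFin; apply: has_deriv_unique du; apply: df.
by rewrite (le_lt_trans nx xt) lt_neqAle tn (le_trans ty).
Qed.

(** The increment is the integral of the derivative, which may be clamped to [m, L] at the cost of a
    null set. This is the passage from pointwise constraints to increments; the crude bounds [m0],
    [L0] only ensure that [F] is Lipschitz. *)
Lemma slopes_ae m0 L0 m L F : slopes m0 L0 F ->
  (\forall x \ae mu, exists2 l, has_deriv F x l & m <= l <= L) -> slopes m L F.
Proof.
move=> sF aF; pose K : R := `|m0| + `|L0|.
have /lipschitz_density[u [mu_ uK uE du]] : slopes (- K) K F.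
  apply: slopes_le sF; rewrite /K.
    by have := lerNnormlW (lexx `|m0|); have := normr_ge0 L0; lra.
  by have := ler_norm L0; have := normr_ge0 m0; lra.
have mL : m <= L by have [x _ [l _ /andP[]]] := ae_exists aF ltr01; exact: le_trans.
pose v x := clamp m L (u x).
have mv : measurable_fun setT v by exact: measurable_clamp.
have vmL x : m <= v x <= L by exact: clamp_in.
have vK x : `|v x| <= `|m| + `|L|.
  have /andP[h1 h2] := vmL x; rewrite ler_norml; apply/andP; split.
    by have := lerNnormlW (lexx `|m|); have := normr_ge0 L; lra.
  by have := ler_norm L; have := normr_ge0 m; lra.
move=> x y xy; have -> : F y - F x = \int[mu]_(t in `]x, y]%classic) v t.
  rewrite uE// /Rintegral; congr fine; apply: ae_eq_integral => //.
  - by apply/measurable_EFinP; exact: measurable_funTS.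
  - by apply/measurable_EFinP; exact: measurable_funTS.
  apply: aeS2 aF du => t [l dl ml] dl' _ /=; congr EFin.
  by rewrite /v -(has_deriv_unique dl dl') clampK.
have cE c : \int[mu]_(t in `]x, y]%classic) c = c * (y - x).
  rewrite Rintegral_cst//= lebesgue_measure_itv/= lte_fin.
  by case: ifPn => //= xy'; rewrite (_ : x = y) ?subrr//; lra.
have ci c : mu.-integrable `]x, y]%classic (EFin \o cst c).
  by apply: (@integrable_bounded (cst c) `|c|).
have vi := integrable_bounded x y mv vK.
rewrite -!cE; apply/andP; split.
  by apply: le_Rintegral (ci m) vi _ => // t _; case/andP: (vmL t).
by apply: le_Rintegral vi (ci L) _ => // t _; case/andP: (vmL t).
Qed.

Lemma Rintegral_slopes v L F : measurable_fun setT v -> slopes (- L) L F ->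
  (\forall x \ae mu, has_deriv F x (v x)) ->
  forall x y, x <= y -> \int[mu]_(t in `]x, y]%classic) v t = F y - F x.
Proof.
move=> mv sF dF x y xy; have [w [mw wL wE dw]] := lipschitz_density sF.
rewrite wE// /Rintegral; congr fine; apply: ae_eq_integral => //.
- by apply/measurable_EFinP; exact: measurable_funTS.
- by apply/measurable_EFinP; exact: measurable_funTS.
apply: aeS2 dF dw => t d1 d2 _; congr EFin; exact: has_deriv_unique d1 d2.
Qed.

Lemma has_deriv_ae_eq m L F G m' L' : slopes m L F -> slopes m' L' G ->
  (\forall x \ae mu, exists2 l, has_deriv F x l & has_deriv G x l) ->
  F 0 = G 0 -> F = G.
Proof.
move=> sF sG dFG FG0.
have sH : slopes (m - L') (L - m') (fun x => F x - G x).
  by move=> x y xy; have := sF _ _ xy; have := sG _ _ xy; lra.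
have /(slopes_ae sH) : \forall x \ae mu, exists2 l, has_deriv (fun x => F x - G x) x l & 0 <= l <= 0.
  apply: aeS dFG => x [l dF dG]; exists 0; rewrite ?lexx//.
  by rewrite -(subrr l); exact: has_derivB.
move=> s; apply/funext => x; have [x0|/ltW x0] := leP 0 x.
  by have := s _ _ x0; lra.
by have := s _ _ x0; lra.
Qed.

(** Both functions are continuous, and a set of full measure is dense. *)
Lemma slopes_ae_eq m L F G m' L' : slopes m L F -> slopes m' L' G ->
  (\forall x \ae mu, F x = G x) -> F = G.
Proof.
move=> sF sG FG; apply/funext => x; apply/eqP; rewrite -subr_eq0 -normr_le0.
apply/ler_addgt0Pr => e e0; rewrite add0r.
have : (fun y => F y - G y) y @[y --> x] --> F x - G x.
  by apply: cvgB; [exact: slopes_continuous sF _|exact: slopes_continuous sG _].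
move=> /cvgrPdist_lt /(_ e e0) [r /= r0 H].
have /(ae_exists FG)[y /andP[xy yr] FGy] : x < x + r / 2 by rewrite ltrDl divr_gt0.
have := H y; rewrite FGy subrr subr0 => /(_ _)/ltW; apply.
by rewrite /= ltr0_norm ?subr_lt0// opprB ltrBlDl (le_lt_trans yr)// ltrD2l ltr_pdivrMr// ltr_pMr// ltr1n.
Qed.

End FTC.

(** * Borel representatives of Lebesgue measurable functions *)

Section borel_version.
Context {R : realType}.
Local Notation mu := (@lebesgue_measure R).

(** A Lebesgue measurable set is Borel up to a negligible set. For the superlevel sets at rational
    levels, the countably many negligible parts lie in one Borel null set [B]. Off [B] every
    superlevel set is a countable union of the Borel parts, and [g] is [f] reset to 0 on [B]. *)
Lemma borel_version (f : R -> R) : Lebesgue_measurable_fun f ->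
  exists2 g : R -> R, measurable_fun setT g & \forall x \ae mu, f x = g x.
Proof.
move=> mf.
have /choice[AN ANE] (q : rat) : exists AN : set (measurableTypeR R) * set R,
    [/\ measurable AN.1, mu.-negligible AN.2 &
        f @^-1` `]ratr q, +oo[%classic = AN.1 `|` AN.2].
  have := mf (@measurableT _ _) `]ratr q, +oo[%classic (measurable_itv _).
  rewrite setTI.
  rewrite -[measurable]/((@wlength R idfun)^*%mu.-cara.-measurable).
  rewrite -completed_caratheodory_measurable g_sigma_completed_algebra_genE.
  by move=> [A mA [N nN <-]]; exists (A, N).
have : mu.-negligible (\bigcup_q (AN q).2).
  rewrite (_ : \bigcup_q _ = \bigcup_n (if choice.unpickle n is Some q then (AN q).2 else set0)).
    apply: negligible_bigcup => n; case: choice.unpickle => [q|]; last exact: negligible_set0.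
    by have [] := ANE q.
  apply/seteqP; split => [x [q _ qx]|x [n _]].
    by apply: (ex_intro2 _ _ (choice.pickle q) I); rewrite choice.pickleK.
  by case: choice.unpickle => // q qx; exists q.
move=> [B [mB B0 NB]]; exists (f \_ (~` B)); last first.
  exists B; split => // x /= fx; apply: contrapT => Bx; apply: fx.
  by rewrite patchE mem_set.
apply/(measurable_restrictT _ _).1; first exact: measurableC.
apply: (measurability _ (RGenOInfty.measurableE R)) => _ [_ [x ->] <-].
rewrite (_ : _ `&` _ = ~` B `&` \bigcup_(q in [set q : rat | x < ratr q]) (AN q).1).
  apply: measurableI; first exact: measurableC.
  rewrite bigcup_mkcond; apply: bigcupT_measurable_rat => q.
  by case: ifPn => // _; have [] := ANE q.
apply/seteqP; split => y [nBy /=]; rewrite in_itv/= andbT.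
  move=> xfy; split => //; have [q] := rat_in_itvoo xfy.
  rewrite in_itv/= => /andP[xq qf]; exists q => //=.
  have [_ _ /seteqP[+ _]] := ANE q => /(_ y); rewrite /= in_itv/= qf => /(_ isT).
  by case=> // Ny; exfalso; apply: nBy; apply: NB; exists q.
move=> [q /= xq Ay]; split => //.
have [_ _ /seteqP[_ +]] := ANE q => /(_ y); rewrite /= in_itv/= andbT => h.
by apply: (lt_trans xq); apply: h; left.
Qed.

End borel_version.

(** * An induction principle for integrable functions *)

Section L1_ind.
Import HBSimple.
Context {R : realType}.
Local Notation mu := (@lebesgue_measure R).
Implicit Types (f g h : R -> R).

Definition L1fun f : Prop := mu.-integrable setT (EFin \o f).

Lemma cvge0_lt (u : (\bar R)^nat) (e : R) : u @ \oo --> 0%E -> 0 < e ->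
  exists n, (u n < e%:E)%E.
Proof.
move=> u0 e0; have := u0 [set x | x < e%:E]%E.
have N0 : nbhs (0%E : \bar R) [set x | x < e%:E]%E.
  by apply: open_nbhs_nbhs; split; [exact: open_ereal_lt_ereal|rewrite /= lte_fin].
by move=> /(_ N0) [n _ /(_ n (leqnn n))] ?; exists n.
Qed.

Lemma L1fun_indic (A : set (measurableTypeR R)) :
  measurable A -> (mu A < +oo)%E -> L1fun \1_A.
Proof.
move=> mA Aoo; apply/integrableP; split.
  by apply/measurable_EFinP; exact: measurable_indic.
under eq_integral do rewrite /= ger0_norm//.
by rewrite integral_indic// setIT.
Qed.

Lemma L1funZ c f : L1fun f -> L1fun (fun x => c * f x).
Proof.
move=> fi; have := @integrableZl _ _ _ mu _ measurableT c _ fi.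
by apply: eq_integrable.
Qed.

Lemma L1funD f g : L1fun f -> L1fun g -> L1fun (fun x => f x + g x).
Proof.
move=> fi gi; have := @integrableD _ _ _ mu _ measurableT _ _ fi gi.
by apply: eq_integrable.
Qed.

Lemma L1fun_restrict (A : set (measurableTypeR R)) f : measurable A ->
  mu.-integrable A (EFin \o f) -> L1fun (f \_ A).
Proof. by move=> mA fi; rewrite /L1fun -restrict_EFin -integrable_mkcond. Qed.

Section ind.
Variable P : (R -> R) -> Prop.
Hypothesis Pitv : forall a b, a <= b -> P \1_(`]a, b]%classic : set R).
Hypothesis PD : forall f g, L1fun f -> L1fun g -> P f -> P g ->
  P (fun x => f x + g x).
Hypothesis PZ : forall c f, L1fun f -> P f -> P (fun x => c * f x).
Hypothesis Plim : forall f, L1fun f -> (forall e, 0 < e -> exists h,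
    [/\ L1fun h, P h & (\int[mu]_x `|(f x - h x)%:E| <= e%:E)%E]) -> P f.

Let I (n : nat) : set (measurableTypeR R) := `]- n%:R, n%:R]%classic.

Let mI n : measurable (I n). Proof. exact: measurable_itv. Qed.

Let muI n : (mu (I n) < +oo)%E.
Proof.
by rewrite /I lebesgue_measure_itv/=; case: ifPn => // _; rewrite -EFinB ltry.
Qed.

Let muAI (A : set (measurableTypeR R)) n : measurable A ->
  (mu (A `&` I n) < +oo)%E.
Proof.
move=> mA; apply: le_lt_trans (muI n); apply: (@le_measure _ _ _ mu); rewrite ?inE//.
exact: measurableI.
Qed.

Let L1AI (A : set (measurableTypeR R)) n : measurable A ->
  L1fun \1_(A `&` I n).
Proof.
by move=> mA; apply: L1fun_indic; [exact: measurableI|exact: muAI].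
Qed.

(** The bounded window [I n] keeps every indicator integrable, so that [PD], [PZ] and [Plim] apply
    to it. *)
Let H n : set (set (measurableTypeR R)) :=
  [set A | (measurable : set (set (measurableTypeR R))) A /\ P \1_(A `&` I n)].

Let lambdaH n : lambda_system setT (H n).
Proof.
split => //.
- split; first exact: measurableT.
  by rewrite setTI; apply: Pitv; rewrite lerNl (le_trans _ (ler0n _ _))// oppr_le0.
- move=> X Y YX [mX PX] [mY PY]; split; first exact: measurableD.
  have -> : \1_((X `\` Y) `&` I n) =
      (fun x => \1_(X `&` I n) x + (-1) * \1_(Y `&` I n) x) :> (R -> R).
    apply/funext => x; rewrite !indicE in_setI classical_sets.in_setD !in_setI.
    have : (x \in Y) ==> (x \in X) by apply/implyP; rewrite !inE; exact: YX.
    case: (x \in X); case: (x \in Y) => // _; case: (x \in I n);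
      by rewrite /= ?mulr0 ?mulr1 ?addr0 ?subrr.
  by apply: PD; [exact: L1AI|apply: L1funZ; exact: L1AI|exact: PX|apply: PZ => //; exact: L1AI].
- move=> F ndF FH; have mF k : measurable (F k) by have [] := FH k.
  have mU : measurable (\bigcup_k F k : set (measurableTypeR R)) by exact: bigcupT_measurable.
  split => //; apply: Plim => [|e e0]; first exact: L1AI.
  (* These sets decrease to the empty set inside a window of finite measure, so their measures,
     which are the L1 errors, tend to 0. *)
  pose D k : set (measurableTypeR R) := (\bigcup_k F k `&` I n) `\` F k.
  have mD k : measurable (D k) by apply: measurableD => //; exact: measurableI.
  have D0 : \bigcap_k D k = set0.
    apply/seteqP; split => // x Dx; have [[[k _ Fk] _] _] := Dx 0%N Logic.I.
    by have [_] := Dx k Logic.I.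
  have : mu (D k) @[k --> \oo] --> mu (\bigcap_k D k).
    apply: nonincreasing_cvg_mu => //.
    + apply: le_lt_trans (muI n); apply: (@le_measure _ _ _ mu); rewrite ?inE//.
      by move=> x [[]].
    + by rewrite D0.
    + move=> k l kl; apply/subsetPset => x [UIx nF]; split => // Fk; apply: nF; move: Fk.
      by have /subsetPset := ndF _ _ kl; exact.
  rewrite D0 measure0 => /cvge0_lt /(_ e0) [k /ltW De].
  exists \1_(F k `&` I n); split; [exact: L1AI|by have [] := FH k|].
  apply: le_trans De; rewrite -(setIT (D k)) -integral_indic// le_eqVlt; apply/orP; left; apply/eqP.
  apply: eq_integral => x _; rewrite !indicE classical_sets.in_setD !in_setI.
  have [Fx|Fx] := boolP (x \in F k).
    rewrite (_ : x \in _ = true) /= ?subrr ?andbF ?normr0//.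
    by apply/mem_set; exists k => //; exact/set_mem.
  by rewrite /= subr0 andbT; case: (_ && _); rewrite /= ?normr1 ?normr0.
Qed.

Let Hitv n : @ocitv R `<=` H n.
Proof.
move=> X [[a b] _ <-] /=; split; first exact: measurable_itv.
have : ocitv (`]a, b] `&` I n) by apply: ocitvI; exact: is_ocitv.
move=> /ocitvP[->|[[c e] /= ce ->]]; last exact/Pitv/ltW.
have -> : (set0 : set R) = `]0%R, 0%R]%classic by rewrite set_itvoc0.
exact: Pitv.
Qed.

Let Pindic n (A : set (measurableTypeR R)) : measurable A -> P \1_(A `&` I n).
Proof.
move=> mA; suff : H n A by case.
by move: A mA; apply: (lambda_system_subset (@ocitvI R) (lambdaH n) (@Hitv n)).
Qed.

(** The pi-lambda theorem leads from half-open intervals to measurable subsets of a window, sums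
    lead to simple functions, and L1 limits to functions supported in a window, then to all of L1 by
    dominated convergence. *)
Lemma L1_ind f : L1fun f -> P f.
Proof.
move=> fi.
have P0 : P (fun=> 0).
  have := @Pindic 0%N set0 measurable0; rewrite set0I indic0; apply.
have Plim' g : L1fun g -> (forall e, 0 < e -> exists h,
    [/\ L1fun h, P h & (\int[mu]_x `|(g x - h x)%:E| < e%:E)%E]) -> P g.
  move=> gi H1; apply: Plim => // e /H1[h [? ? /ltW ?]]; by exists h.
apply: (@Plim' _) => // e e0.
have cvgI : (\int[mu]_x `|(f \_ (I n)) x - f x|%:E)%E @[n --> \oo] --> 0%E.
  have mfI n : measurable_fun setT (f \_ (I n)).
    have : L1fun (f \_ (I n)) by apply: L1fun_restrict => //; exact: integrableS fi.
    by move=> /(measurable_int mu) /measurable_EFinP.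
  have [] := @dominated_convergence _ (measurableTypeR R) R mu setT measurableT
    (fun n => EFin \o (f \_ (I n))) (EFin \o f) (fun x => `|f x|%:E).
  - by move=> n; apply/measurable_EFinP.
  - exact: measurable_int fi.
  - apply: aeW => x _; apply: cvg_near_cst.
    exists (Num.truncn `|x|).+1 => // n /= xn; rewrite patchE mem_set//.
    have := truncnS_gt `|x|; rewrite /I /= in_itv/= -(ler_nat R) in xn * => xt.
    have := lt_le_trans xt xn; rewrite ltr_norml => /andP[-> /ltW] //.
  - have := integrable_abse fi; apply: eq_integrable => //.
  - apply: aeW => x n _; rewrite /= lee_fin patchE; case: ifPn => // _.
    by rewrite normr0.
  - by move=> _ + _; apply: cvg_trans; apply: near_eq_cvg; apply: nearW => n /=.
have [n fn] := cvge0_lt cvgI e0.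
exists (f \_ (I n)); split.
- by apply: L1fun_restrict => //; exact: integrableS fi.
- apply: (@Plim' _) => [|{e e0 fn} e e0].
    by apply: L1fun_restrict => //; exact: integrableS fi.
  have fiI : mu.-integrable (I n) (EFin \o f) by exact: integrableS fi.
  have [h [hi _ /cvge0_lt /(_ e0) [k hk]]] := approximation_sfun_integrable (mI n) fiI.
  exists (h k \_ (I n)); split.
  + exact: L1fun_restrict.
  + pose s := fset_set (range (h k)).
    have -> : h k \_ (I n) =
        fun x => \sum_(i < #|` s|) s`_i * \1_(h k @^-1` [set s`_i] `&` I n) x.
      apply/funext => x; rewrite patchE; case: ifPn => xI.
        rewrite fimfunEord; apply: eq_bigr => i _.
        by rewrite !indicE in_setI xI andbT.
      rewrite big1// => i _; rewrite indicE in_setI (negbTE xI) andbF mulr0//.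
    suff : L1fun (fun x => \sum_(i < #|` s|) s`_i * \1_(h k @^-1` [set s`_i] `&` I n) x)
        /\ P (fun x => \sum_(i < #|` s|) s`_i * \1_(h k @^-1` [set s`_i] `&` I n) x) by case.
    have ms i : measurable (h k @^-1` [set s`_i] : set (measurableTypeR R)).
      by rewrite -[X in measurable X]setTI; exact: measurable_funP.
    elim: #|` s| => [|N [IH1 IH2]].
      under eq_fun do rewrite big_ord0; split => //.
      exact: integrable0.
    under eq_fun do rewrite big_ord_recr/=.
    split.
      by apply: L1funD => //; apply: L1funZ; exact: L1AI.
    by apply: PD => //; [apply: L1funZ; exact: L1AI|apply: PZ; [exact: L1AI|exact: Pindic]].
  + apply: le_lt_trans hk; rewrite [leRHS]integral_mkcond le_eqVlt; apply/orP; left; apply/eqP.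
    by apply: eq_integral => x _; rewrite !patchE; case: ifPn => //; rewrite subrr /= normr0.
- apply: le_lt_trans fn; rewrite le_eqVlt; apply/orP; left; apply/eqP.
  by apply: eq_integral => x _; rewrite /= distrC.
Qed.

End ind.
End L1_ind.

(** * Finite sums and the Cauchy-Schwarz inequality *)

Section more_deriv.
Context {R : realType}.
Local Notation mu := (@lebesgue_measure R).
Implicit Types (F G : R -> R) (m L x y l : R).

Lemma ae_fin (I : finType) (P : I -> R -> Prop) :
  (forall i, \forall x \ae mu, P i x) -> \forall x \ae mu, forall i, P i x.
Proof.
move=> aP; suff : \forall x \ae mu, forall i, i \in enum I -> P i x.
  by apply: aeS => x H i; apply: H; rewrite mem_enum.
elim: (enum I) => [|i s IH]; first exact: aeW.
apply: aeS2 (aP i) IH => x Pi Ps j; rewrite in_cons => /orP[/eqP ->//|].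
exact: Ps.
Qed.

Lemma slopes_sum (I : finType) (m L : I -> R) (F : I -> R -> R) :
  (forall i, slopes (m i) (L i) (F i)) ->
  slopes (\sum_i m i) (\sum_i L i) (fun y => \sum_i F i y).
Proof.
move=> sF x y xy; rewrite -sumrB !mulr_suml.
by apply/andP; split; apply: ler_sum => i _; have /andP[] := sF i _ _ xy.
Qed.

Lemma slopesZ L c F : slopes (- L) L F ->
  slopes (- (`|c| * L)) (`|c| * L) (fun y => c * F y).
Proof.
move=> sF x y xy; rewrite -mulrBr mulNr -ler_norml normrM -mulrA.
by rewrite ler_wpM2l// ler_norml -mulNr sF.
Qed.

Lemma slopes_affine m L F : slopes m L F -> forall t, slopes m L (fun y => F (y + t)).
Proof.
move=> sF t x y xy; have := sF (x + t) (y + t).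
by rewrite lerD2r => /(_ xy); rewrite opprD addrACA subrr addr0.
Qed.

Lemma has_deriv_sum (I : finType) (F : I -> R -> R) (l : I -> R) y :
  (forall i, has_deriv (F i) y (l i)) ->
  has_deriv (fun y => \sum_i F i y) y (\sum_i l i).
Proof.
move=> dF; suff H s : has_deriv (fun y => \sum_(i <- s) F i y) y (\sum_(i <- s) l i).
  exact: H.
elim: s => [|i s IH].
  by under eq_fun do rewrite big_nil; rewrite big_nil; exact: has_deriv_cst.
by under eq_fun do rewrite big_cons; rewrite big_cons; exact: has_derivD.
Qed.

(** Cauchy-Schwarz with bounds in place of norms: sum the squares of [B * f i - A * v i] and divide
    by [2 * (A * B)]. If [A] or [B] is 0, the corresponding vector vanishes. *)
Lemma dot_le (I : finType) (f v : I -> R) (A B : R) : 0 <= A -> 0 <= B ->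
  \sum_i f i ^+ 2 <= A ^+ 2 -> \sum_i v i ^+ 2 <= B ^+ 2 ->
  \sum_i f i * v i <= A * B.
Proof.
have sum0 (g : I -> R) : \sum_i g i ^+ 2 <= 0 ^+ 2 -> forall i, g i = 0.
  rewrite expr0n/= => g0 i; apply/eqP; rewrite -sqrf_eq0 eq_le sqr_ge0 andbT.
  by apply: le_trans g0; rewrite (bigD1 i)//= lerDl sumr_ge0// => j _; rewrite sqr_ge0.
rewrite le_eqVlt => /predU1P[<- _ /sum0 f0 _|A0].
  by rewrite mul0r big1// => i _; rewrite f0 mul0r.
rewrite le_eqVlt => /predU1P[<- _ /sum0 v0|B0 fA vB].
  by rewrite mulr0 big1// => i _; rewrite v0 mulr0.
have AB0 : 0 < 2 * (A * B) by rewrite !mulr_gt0.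
rewrite -(ler_pM2l AB0) mulr_sumr.
apply: (@le_trans _ _ (\sum_i (B ^+ 2 * f i ^+ 2 + A ^+ 2 * v i ^+ 2))).
  by apply: ler_sum => i _; have := sqr_ge0 (B * f i - A * v i); rewrite sqrrB !exprMn; lra.
rewrite big_split/= -!mulr_sumr.
have h1 := ler_wpM2l (sqr_ge0 B) fA; have h2 := ler_wpM2l (sqr_ge0 A) vB.
by apply: le_trans (lerD h1 h2) _; rewrite le_eqVlt; apply/orP; left; apply/eqP; ring.
Qed.

Lemma dot_le_norm (I : finType) (f v : I -> R) (A B : R) : 0 <= A -> 0 <= B ->
  \sum_i f i ^+ 2 <= A ^+ 2 -> \sum_i v i ^+ 2 <= B ^+ 2 ->
  - (A * B) <= \sum_i f i * v i <= A * B.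
Proof.
move=> A0 B0 fA vB; rewrite dot_le// andbT lerNl -sumrN.
rewrite (eq_bigr (fun i => - f i * v i)) => [|i _]; last by rewrite mulNr.
by apply: dot_le => //; under eq_bigr do rewrite sqrrN.
Qed.

End more_deriv.

(** * Characteristic coordinates and Lagrangian data *)

Section state_algebra.
Context {R : realType} {d : nat}.
Implicit Types (U : state R d) (c : bool) (o : 'I_d.+1).

(* The characteristic coordinates: [chi true] lists [tau + v, eta - zeta], which
   travel with [y + t], and [chi false] lists [tau - v, eta + zeta], which travel
   with [y - t]. *)
Definition chi c o U : R :=
  if unlift ord0 o is Some k
  then (if c then eta U 0 k - zeta U 0 k else eta U 0 k + zeta U 0 k)
  else (if c then tau U + vel U else tau U - vel U).

Definition unchi (f : bool -> 'I_d.+1 -> R) : state R d :=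
  mk_state ((f true ord0 + f false ord0) / 2) ((f true ord0 - f false ord0) / 2)
    (\row_k ((f true (lift ord0 k) + f false (lift ord0 k)) / 2))
    (\row_k ((f false (lift ord0 k) - f true (lift ord0 k)) / 2)).

Lemma tau_mk (a b : R) (x y : 'rV[R]_d) : tau (mk_state a b x y) = a.
Proof. by rewrite /tau /mk_state !row_mxKl mxE eqxx. Qed.

Lemma vel_mk (a b : R) (x y : 'rV[R]_d) : vel (mk_state a b x y) = b.
Proof. by rewrite /vel /mk_state !row_mxKl row_mxKr mxE eqxx. Qed.

Lemma eta_mk (a b : R) (x y : 'rV[R]_d) : eta (mk_state a b x y) = x.
Proof. by rewrite /eta /mk_state row_mxKl row_mxKr. Qed.

Lemma zeta_mk (a b : R) (x y : 'rV[R]_d) : zeta (mk_state a b x y) = y.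
Proof. by rewrite /zeta /mk_state row_mxKr. Qed.

Lemma chi0 c U : chi c ord0 U = if c then tau U + vel U else tau U - vel U.
Proof. by rewrite /chi unlift_none. Qed.

Lemma chiS c k U : chi c (lift ord0 k) U =
  if c then eta U 0 k - zeta U 0 k else eta U 0 k + zeta U 0 k.
Proof. by rewrite /chi liftK. Qed.

Lemma chi_unchi c o f : chi c o (unchi f) = f c o.
Proof.
case: (unliftP ord0 o) => [k|] ->.
  by rewrite chiS eta_mk zeta_mk !mxE; case: c; field.
by rewrite chi0 tau_mk vel_mk; case: c; field.
Qed.

Lemma tau_chi U : tau U = (chi true ord0 U + chi false ord0 U) / 2.
Proof. by rewrite !chi0; field. Qed.

Lemma vel_chi U : vel U = (chi true ord0 U - chi false ord0 U) / 2.
Proof. by rewrite !chi0; field. Qed.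

Lemma eta_chi U k :
  eta U 0 k = (chi true (lift ord0 k) U + chi false (lift ord0 k) U) / 2.
Proof. by rewrite !chiS; field. Qed.

Lemma zeta_chi U k :
  zeta U 0 k = (chi false (lift ord0 k) U - chi true (lift ord0 k) U) / 2.
Proof. by rewrite !chiS; field. Qed.

Lemma chi_relP (W Wp Wm : state R d) :
  [/\ vel W + tau W = vel Wp + tau Wp, vel W - tau W = vel Wm - tau Wm,
      eta W - zeta W = eta Wp - zeta Wp & eta W + zeta W = eta Wm + zeta Wm] <->
  forall c o, chi c o W = chi c o (if c then Wp else Wm).
Proof.
split=> [[E1 E2 E3 E4] c o|E].
  case: (unliftP ord0 o) => [k|] ->.
    rewrite !chiS; case: c; [move/rowP : E3|move/rowP : E4] => /(_ k);
    by rewrite !mxE.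
  by rewrite !chi0; case: c; lra.
have := E true ord0; have := E false ord0; rewrite !chi0 => e1 e2.
split; [lra|lra| |].
  by apply/rowP => k; have := E true (lift ord0 k); rewrite !chiS !mxE.
by apply/rowP => k; have := E false (lift ord0 k); rewrite !chiS !mxE.
Qed.

Lemma chi_coord c o : exists i j (e : R), forall U, chi c o U = U 0 i + e * U 0 j.
Proof.
case: (unliftP ord0 o) => [k|] ->.
  exists (lshift d (rshift (1 + 1) k)), (rshift (1 + 1 + d) k), (if c then -1 else 1).
  by move=> U; rewrite chiS /eta /zeta !mxE; case: c; ring.
exists (lshift d (lshift d (lshift 1 ord0))), (lshift d (lshift d (rshift 1 ord0))),
  (if c then 1 else -1).
by move=> U; rewrite chi0 /tau /vel !mxE; case: c; ring.
Qed.

Lemma state_ind (P : 'I_(1 + 1 + d + d) -> Prop) :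
  P (lshift d (lshift d (lshift 1 ord0))) ->
  P (lshift d (lshift d (rshift 1 ord0))) ->
  (forall k, P (lshift d (rshift (1 + 1) k))) ->
  (forall k, P (rshift (1 + 1 + d) k)) -> forall i, P i.
Proof.
move=> P1 P2 P3 P4 i; case: (splitP i) => [j|k] ij; last first.
  by rewrite (_ : i = rshift (1 + 1 + d) k)//; exact: val_inj.
rewrite (_ : i = lshift d j); last exact: val_inj.
case: (splitP j) => [j'|k] jj; last first.
  by rewrite (_ : j = rshift (1 + 1) k)//; exact: val_inj.
rewrite (_ : j = lshift d j'); last exact: val_inj.
case: (splitP j') => k jk; rewrite (ord1 k) in jk *.
  by rewrite (_ : j' = lshift 1 ord0)//; exact: val_inj.
by rewrite (_ : j' = rshift 1 ord0)//; exact: val_inj.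
Qed.

Lemma mk_state_h (a b : R) (x y : 'rV[R]_d) :
  mk_state a b x y 0 (lshift d (lshift d (lshift 1 ord0))) = a.
Proof. by rewrite /mk_state !row_mxEl mxE eqxx. Qed.

Lemma mk_state_q (a b : R) (x y : 'rV[R]_d) :
  mk_state a b x y 0 (lshift d (lshift d (rshift 1 ord0))) = b.
Proof. by rewrite /mk_state !row_mxEl row_mxEr mxE eqxx. Qed.

Lemma mk_state_Y (a b : R) (x y : 'rV[R]_d) k :
  mk_state a b x y 0 (lshift d (rshift (1 + 1) k)) = x 0 k.
Proof. by rewrite /mk_state row_mxEl row_mxEr. Qed.

Lemma mk_state_Z (a b : R) (x y : 'rV[R]_d) k :
  mk_state a b x y 0 (rshift (1 + 1 + d) k) = y 0 k.
Proof. by rewrite /mk_state row_mxEr. Qed.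

Variables alpha delta : R.

(** In characteristic coordinates [G] bounds tau + v - alpha and tau - v + alpha, hence the sign
    depending on the family. *)
Definition shift_of c : R := if c then alpha else - alpha.

(** The flag [exact] lets the constrained set [M] ([true]) and the relaxed set [CM] ([false]) be
    treated by the same statements. *)
Definition norm_ok (exact : bool) (x : R) : Prop :=
  if exact then x = 1 else x <= 1.

Definition target (exact : bool) : set (state R d) :=
  if exact then M R d else CM R d.

Definition admissible (exact : bool) c (f : 'I_d.+1 -> R) : Prop :=
  shift_of c + delta <= f ord0 <= shift_of c + delta^-1 /\
  norm_ok exact (\sum_o f o ^+ 2).

Lemma G_chi U : G alpha delta U <->
  forall c, shift_of c + delta <= chi c ord0 U <= shift_of c + delta^-1.
Proof.
rewrite /G /=; split=> [[/andP[h1 h2] /andP[h3 h4]] c|h].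
  by rewrite chi0 /shift_of; case: c; lra.
by have := h true; have := h false; rewrite !chi0 /shift_of; lra.
Qed.

Lemma sum_chi c U : \sum_o chi c o U ^+ 2 =
  tau U ^+ 2 + vel U ^+ 2 + enorm (eta U) ^+ 2 + enorm (zeta U) ^+ 2
  + (if c then 2 else - 2) * (tau U * vel U - dot (eta U) (zeta U)).
Proof.
have enorm2 (x : 'rV[R]_d) : enorm x ^+ 2 = \sum_k x 0 k ^+ 2.
  rewrite /enorm sqr_sqrtr; first by apply: eq_bigr => k _; rewrite expr2.
  by apply: sumr_ge0 => k _; rewrite -expr2 sqr_ge0.
rewrite big_ord_recl chi0 !enorm2 /dot.
rewrite (eq_bigr (fun k => eta U 0 k ^+ 2 + zeta U 0 k ^+ 2
    - (if c then 2 else - 2) * (eta U 0 k * zeta U 0 k))); last first.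
  by move=> k _; rewrite chiS; case: c; ring.
by rewrite sumrB big_split/= -mulr_sumr; case: c; ring.
Qed.

(** By [sum_chi] the two squared norms are S + 2 K and S - 2 K, where S is the sum of squares and K
    = tau v - eta . zeta. Their maximum is S + 2 |K|, and both are 1 exactly when S = 1 and K =
    0. *)
Lemma target_chi exact U : (target exact `&` G alpha delta) U <->
  forall c, admissible exact c (fun o => chi c o U).
Proof.
rewrite /setI /=; split => [[tU /G_chi gU] c|h].
  split => //; move: tU; rewrite sum_chi /target /norm_ok.
  case: exact => [[h1 h2]|]; first by rewrite h2 h1 subrr mulr0 addr0.
  rewrite /CM /=; set K := tau U * vel U - _ => h.
  by have := ler_norm K; have := lerNnormlW (lexx `|K|); case: c; lra.
split; last by apply/G_chi => c; have [] := h c.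
have [_] := h true; have [_] := h false; rewrite !sum_chi /target /norm_ok.
case: exact {h} => [h1 h2|]; first by split; lra.
rewrite /CM /=; set K := tau U * vel U - _ => h1 h2.
by case: (ger0P K) => K0; lra.
Qed.

End state_algebra.

Section data.
Context {R : realType} {d : nat} (alpha delta : R).
Local Notation mu := (@lebesgue_measure R).

(** A single flat index makes pointwise convergence a product topology, the setting of Tychonoff's
    theorem. *)
Definition data : Type := {ptws (bool * 'I_d.+1 * R) -> R}.
Implicit Types (w : data) (c : bool) (o : 'I_d.+1).

Definition prim w c o : R -> R := fun y => w (c, o, y).

(* Primitives, in the Lagrangian variable, of the characteristic coordinates of
   initial data valued in [target exact `&` G]. *)
Definition is_data (exact : bool) w : Prop :=
  [/\ forall c o, prim w c o 0 = 0,
      forall c o, slopes (- 1) 1 (prim w c o) &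
      forall c, \forall y \ae mu, exists2 f : 'I_d.+1 -> R,
        forall o, has_deriv (prim w c o) y (f o) &
        admissible alpha delta exact c f].

Definition is_data_incr w : Prop :=
  [/\ forall c o, prim w c o 0 = 0,
      forall c, slopes (shift_of alpha c + delta) (shift_of alpha c + delta^-1)
        (prim w c ord0) &
      forall c x y, x <= y ->
        \sum_o (prim w c o y - prim w c o x) ^+ 2 <= (y - x) ^+ 2].

Lemma is_data_closed w : is_data true w -> is_data false w.
Proof.
move=> [w0 sw aw]; split => // c; apply: aeS (aw c) => y [f df [h1 h2]].
by exists f => //; split => //; rewrite /norm_ok h2.
Qed.

(* Duality: the increment is tested against its own direction. *)
Lemma is_data_incrP w : is_data false w <-> is_data_incr w.
Proof.
split=> [[w0 sw aw]|[w0 sw qw]].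
  split => // [c|c x y xy].
    by apply: slopes_ae (sw c ord0) _; apply: aeS (aw c) => y [f df [h _]]; exists (f ord0).
  pose v o := prim w c o y - prim w c o x.
  rewrite -/(\sum_o (v o) ^+ 2); set S := \sum_o _.
  have S0 : 0 <= S by apply: sumr_ge0 => o _; rewrite sqr_ge0.
  pose N := Num.sqrt S; have NS : N ^+ 2 = S by rewrite sqr_sqrtr.
  have N0 : 0 <= N by exact: sqrtr_ge0.
  rewrite -NS ler_sqr ?nnegrE ?subr_ge0//.
  move: N0; rewrite le_eqVlt => /predU1P[<-|N0]; first by rewrite subr_ge0.
  (* By Cauchy-Schwarz the derivative of this scalar function is at most [N] almost everywhere,
     while its increment from [x] to [y] is [N ^+ 2]; hence [N <= y - x]. *)
  pose F y := \sum_o v o * prim w c o y.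
  have sF : slopes (\sum_o - (`|v o| * 1)) (\sum_o `|v o| * 1) F.
    by apply: slopes_sum => o; apply: slopesZ.
  have [B sB] : exists B, slopes B N F.
    exists (- N); apply: slopes_ae sF _; apply: aeS (aw c) => z [f df [_ f1]].
    exists (\sum_o v o * f o); first by apply: has_deriv_sum => o; exact: has_derivZ.
    rewrite -[N]mulr1; apply: dot_le_norm => //; first exact: ltW.
      by rewrite NS.
    by rewrite expr1n.
  have := sB x y xy => /andP[_].
  rewrite /F -sumrB (eq_bigr (fun o => v o ^+ 2)) -/S; last first.
    by move=> o _; rewrite -mulrBr expr2.
  by rewrite -NS expr2 ler_pM2l.
have sw1 c o : slopes (- 1) 1 (prim w c o).
  move=> x y xy; rewrite mulN1r mul1r -ler_norml -(ger0_norm (_ : 0 <= y - x)) ?subr_ge0//.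
  rewrite -ler_sqr ?nnegrE// !real_normK ?num_real//; apply: le_trans (qw c x y xy).
  by rewrite (bigD1 o)//= lerDl sumr_ge0// => o' _; rewrite sqr_ge0.
split => // c.
have : forall o, \forall y \ae mu, exists l, has_deriv (prim w c o) y l.
  move=> o; have [u [_ _ _ du]] := lipschitz_density (sw1 c o).
  by apply: aeS du => y dl; exists (u y).
move=> /ae_fin; apply: aeS => y /choice[f df]; exists f => //.
split; first exact: slopes_has_deriv (sw c) (df ord0).
rewrite /norm_ok; set S := \sum_o _.
have S0 : 0 <= S by apply: sumr_ge0 => o _; rewrite sqr_ge0.
pose N := Num.sqrt S; have NS : N ^+ 2 = S by rewrite sqr_sqrtr.
have N0 : 0 <= N by exact: sqrtr_ge0.
rewrite -NS expr_le1//.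
move: N0; rewrite le_eqVlt => /predU1P[<-//|N0].
(* Same duality at the level of derivatives: this function has slopes at most [N] and derivative
   [N ^+ 2] at [y], so [N <= 1]. *)
have sF : slopes (- N) N (fun y => \sum_o f o * prim w c o y).
  move=> x z xz; have xz0 : 0 <= z - x by rewrite subr_ge0.
  rewrite -sumrB (eq_bigr (fun o => f o * (prim w c o z - prim w c o x))); last first.
    by move=> o _; rewrite mulrBr.
  by rewrite mulNr; apply: dot_le_norm; rewrite ?NS//; [exact: ltW|exact: qw].
have /andP[_] := slopes_has_deriv sF (has_deriv_sum (fun o => has_derivZ (f o) (df o))).
by rewrite (eq_bigr (fun o => f o ^+ 2)) -/S -?NS ?expr2 ?ger_pMr//; move=> o _; rewrite expr2.
Qed.

End data.

(** * Approximation of relaxed data by constrained ones *)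

Section zigzag.
Context {R : realType}.
Local Notation mu := (@lebesgue_measure R).
Variables (W C : R -> R) (r : R -> R) (z : nat -> R).
Hypothesis C1 : slopes 0 1 C.
Hypothesis WC : forall x y, x <= y -> `|W y - W x| <= C y - C x.
Hypothesis dC : \forall y \ae mu, has_deriv C y (r y).

Let tent a y := W a + `|C y - C a|.

(* [zigzag n] stays above [W], takes its value at [z 0], ..., [z n.-1], and has
   slope [+r] or [-r] almost everywhere, since every tent does. *)
Fixpoint zigzag n : R -> R :=
  if n is m.+1 then fun y => Num.min (zigzag m y) (tent (z m) y) else tent 0.

Let C_nd x y : x <= y -> C x <= C y.
Proof. by move=> xy; have := C1 xy; rewrite mul0r subr_ge0 => /andP[]. Qed.

Let WCn x y : `|W y - W x| <= `|C y - C x|.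
Proof.
have [xy|/ltW xy] := leP x y; first by rewrite (le_trans (WC xy))// ler_norm.
by rewrite distrC (distrC (C y)) (le_trans (WC xy))// ler_norm.
Qed.

Lemma le_zigzag n y : W y <= zigzag n y.
Proof.
have H a : W y <= tent a y.
  by rewrite /tent -lerBlDl; apply: le_trans (WCn a y); rewrite ler_norm.
by elim: n => [|n IH] //=; rewrite le_min IH H.
Qed.

Lemma zigzag_le k n y : (k < n)%N -> zigzag n y <= tent (z k) y.
Proof.
elim: n => // n IH /=; rewrite ltnS leq_eqVlt => /predU1P[->|/IH h].
  by rewrite ge_min lexx orbT.
by rewrite ge_min h.
Qed.

(** The initial tent is centred at 0 for this purpose: the normalization of primitives at the origin
    is kept. *)
Lemma zigzag0 n : W 0 = 0 -> zigzag n 0 = 0.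
Proof.
move=> W0; apply/eqP; rewrite eq_le; apply/andP; split; last first.
  by rewrite -[leLHS]W0 le_zigzag.
elim: n => [|n IH] /=; first by rewrite /tent W0 subrr normr0 addr0.
by rewrite ge_min IH.
Qed.

Lemma zigzag_lip n x y : `|zigzag n y - zigzag n x| <= `|C y - C x|.
Proof.
have H a x' y' : tent a y' <= tent a x' + `|C y' - C x'|.
  by rewrite /tent -addrA lerD2l addrC -[C y' - C a](subrKA (C x')) ler_normD.
have K m x' y' : zigzag m y' <= zigzag m x' + `|C y' - C x'|.
  elim: m => [|m IH] //=; have := H (z m) x' y'.
  case: (leP (zigzag m x') (tent (z m) x')) => _ h;
    [apply: le_trans IH|apply: le_trans h]; by rewrite ge_min lexx ?orbT.
rewrite ler_norml lerBlDl K andbT lerNl opprB lerBlDl distrC.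
exact: K.
Qed.

Lemma zigzag_slopes n : slopes (- 1) 1 (zigzag n).
Proof.
move=> x y xy; rewrite mulN1r mul1r -ler_norml (le_trans (zigzag_lip _ _ _))//.
by have := C1 xy; have := C_nd xy; rewrite mul0r mul1r => h /andP[_]; rewrite ger0_norm// subr_ge0.
Qed.

Let tent_deriv a : \forall y \ae mu,
  exists2 l, has_deriv (tent a) y l & l ^+ 2 = r y ^+ 2.
Proof.
apply: aeS2 dC (ae_neq a) => y dy; rewrite neq_lt => /orP[ya|ay].
  exists (- r y); last by rewrite sqrrN.
  apply: (@has_deriv_near _ (fun t => W a + (C a - C t))); last first.
    rewrite -[- r y]add0r; apply: has_derivD; first exact: has_deriv_cst.
    by rewrite -[- r y]add0r; apply: has_derivB => //; exact: has_deriv_cst.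
  near=> t; rewrite /tent distrC ger0_norm// subr_ge0 C_nd// ltW//.
  by near: t; exact: lt_nbhsl.
exists (r y) => //.
apply: (@has_deriv_near _ (fun t => W a + (C t - C a))); last first.
  rewrite -[r y]add0r; apply: has_derivD; first exact: has_deriv_cst.
  by rewrite -[r y]subr0; apply: has_derivB => //; exact: has_deriv_cst.
near=> t; rewrite /tent ger0_norm// subr_ge0 C_nd// ltW//.
by near: t; exact: lt_nbhsr.
Unshelve. all: end_near. Qed.

(** A minimum touches from below the function that realizes it. Where both are differentiable their
    difference has a minimum, so the derivatives agree; the slope is thus inherited from one of the
    tents, even at ties. *)
Lemma zigzag_deriv n : \forall y \ae mu,
  exists2 l, has_deriv (zigzag n) y l & l ^+ 2 = r y ^+ 2.
Proof.
elim: n => [|n IH]; first exact: tent_deriv.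
have [u [_ _ _ du]] := lipschitz_density (zigzag_slopes n.+1).
apply: aeS2 (aeI IH (tent_deriv (z n))) du => y [[l dl lr] [l' dl' lr']] dm.
exists (u y) => //.
have touch F k : (forall t, zigzag n.+1 t <= F t) -> zigzag n.+1 y = F y ->
    has_deriv F y k -> u y = k.
  move=> mF mFy dF; apply/eqP; rewrite eq_sym -subr_eq0; apply/eqP.
  apply: (@has_deriv_min0 _ (fun t => F t - zigzag n.+1 t) y).
  - by move=> t; rewrite subr_ge0.
  - by rewrite mFy subrr.
  - exact: has_derivB.
have [h|h] := leP (zigzag n y) (tent (z n) y).
  rewrite (touch _ _ _ _ dl)//= => [t|]; first by rewrite ge_min lexx.
  exact/min_idPl.
rewrite (touch _ _ _ _ dl')//= => [t|]; first by rewrite ge_min lexx orbT.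
by apply/min_idPr/ltW.
Qed.

(** Near a vertex [z k] the zigzag lies between [W] and a tent. The tent exceeds [W y] by at most
    twice the increment of [C] from [z k] to [y], hence the choice of [z k] within [e / 2]. *)
Lemma zigzag_cvg : (forall y e : R, 0 < e -> exists k, `|y - z k| < e) ->
  forall y, zigzag n y @[n --> \oo] --> W y.
Proof.
move=> zd y; apply/cvgrPdist_lt => e e0.
have [k kz] := zd y (e / 2) (divr_gt0 e0 (ltr0Sn R 1)).
exists k.+1 => // n /= kn.
have h1 := le_zigzag n y; have h2 := zigzag_le y kn.
have CC : `|C y - C (z k)| < e / 2.
  apply: le_lt_trans kz.
  have [xy|/ltW xy] := leP (z k) y.
    by have := C1 xy; have := C_nd xy => h /andP[_]; rewrite mul1r !ger0_norm// subr_ge0.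
  rewrite distrC (distrC y).
  by have := C1 xy; have := C_nd xy => h /andP[_]; rewrite mul1r !ger0_norm// subr_ge0.
have h3 := WCn y (z k); rewrite distrC (distrC (C _)) in h3.
rewrite distrC ger0_norm ?subr_ge0//.
have := ler_norm (W (z k) - W y); rewrite distrC in h3.
by move: h2; rewrite /tent; lra.
Qed.

End zigzag.

Section approximation.
Context {R : realType} {d : nat} (alpha delta : R).
Local Notation mu := (@lebesgue_measure R).

Lemma dense_seq : exists z : nat -> R, forall y e : R, 0 < e -> exists k, `|y - z k| < e.
Proof.
exists (fun k => if choice.unpickle k is Some q then ratr (q : rat) else 0) => y e e0.
have : y < y + e by rewrite ltrDl.
move=> /rat_in_itvoo[q]; rewrite in_itv/= => /andP[yq qe].
exists (choice.pickle q); rewrite choice.pickleK distrC gtr0_norm ?subr_gt0//.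
by rewrite ltrBlDl.
Qed.

Lemma sum_split (o1 : 'I_d.+1) (f : 'I_d.+1 -> R) l :
  \sum_o (if o == o1 then l else f o) ^+ 2 = l ^+ 2 + \sum_(o | o != o1) f o ^+ 2.
Proof.
rewrite (bigD1 o1)//= eqxx; congr (_ + _).
by apply: eq_bigr => o /negbTE ->.
Qed.

(* Only one coordinate [o1] other than [ord0] is modified, into a zigzag whose
   slope squared is what the other coordinates lack to lie on the unit sphere;
   the constraint [G], which bears on [ord0], is unaffected. *)
Lemma data_approx (w : data) : (0 < d)%N -> is_data alpha delta false w ->
  exists w_ : nat -> @data R d, (forall n, is_data alpha delta true (w_ n)) /\
    forall i, w_ n i @[n --> \oo] --> w i.
Proof.
move=> d0 dw; have [w0 sw aw] := dw.
pose o1 : 'I_d.+1 := lift ord0 (Ordinal d0).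
have [z zd] := dense_seq.
have H c : exists C r : R -> R, [/\ slopes 0 1 C,
    forall x y, x <= y -> `|prim w c o1 y - prim w c o1 x| <= C y - C x,
    \forall y \ae mu, has_deriv C y (r y) &
    \forall y \ae mu, exists2 f : 'I_d.+1 -> R,
        forall o, has_deriv (prim w c o) y (f o) &
        admissible alpha delta false c f /\ r y ^+ 2 = 1 - \sum_(o | o != o1) f o ^+ 2].
  have /choice[u uP] : forall o, exists u : R -> R, [/\ measurable_fun setT u,
      forall y, `|u y| <= 1 & \forall y \ae mu, has_deriv (prim w c o) y (u y)].
    by move=> o; have [u [? ? _ ?]] := lipschitz_density (sw c o); exists u.
  (* The missing slope of the coordinate [o1]; the clamp is inactive almost everywhere and makes [r]
     bounded and defined at every point. *)
  pose r y := Num.sqrt (clamp 0 1 (1 - \sum_(o | o != o1) u o y ^+ 2)).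
  have clin (t : R) : 0 <= clamp 0 1 t <= 1 by apply: clamp_in; exact: ler01.
  have mr : measurable_fun setT r.
    have msq : measurable_fun setT (Num.sqrt : R -> R).
      by apply: continuous_measurable_fun; exact: sqrt_continuous.
    have mq : measurable_fun setT (fun y : R => clamp 0 1 (1 - \sum_(o | o != o1) u o y ^+ 2)).
      apply: measurable_clamp; apply: measurable_funB => //.
      under eq_fun do rewrite big_mkcond.
      apply: (@measurable_sum _ _ _ _ _ _ (fun o y => if o != o1 then u o y ^+ 2 else 0)) => o.
      case: (o != o1); last exact: measurable_cst.
      apply: measurable_funX.
      by have [] := uP o.
    exact: (measurableT_comp msq mq).
  have r01 y : 0 <= r y <= 1.
    rewrite sqrtr_ge0/= -[leRHS]sqrtr1 ler_wsqrtr//.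
    by have /andP[] := clin (1 - \sum_(o | o != o1) u o y ^+ 2).
  have r1 y : `|r y| <= 1 by have /andP[h1 h2] := r01 y; rewrite ger0_norm.
  have [C [_ sC _ dC]] := primitive_exists mr r1.
  have main : \forall y \ae mu, exists2 f : 'I_d.+1 -> R,
        forall o, has_deriv (prim w c o) y (f o) &
        admissible alpha delta false c f /\ r y ^+ 2 = 1 - \sum_(o | o != o1) f o ^+ 2.
    have du : \forall y \ae mu, forall o, has_deriv (prim w c o) y (u o y).
      by apply: ae_fin => o; have [] := uP o.
    apply: aeS2 (aw c) du => y [f df [h1 h2]] du; exists f => //; split => //.
    have fu o : f o = u o y := has_deriv_unique (df o) (du o).
    under eq_bigr do rewrite fu.
    move: h2; rewrite /norm_ok (bigD1 o1)//=; under eq_bigr do rewrite fu.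
    set S := \sum_(i | _) _ => h2.
    have S0 : 0 <= S by apply: sumr_ge0 => o _; rewrite sqr_ge0.
    have := sqr_ge0 (f o1) => f0.
    have S01 : 0 <= 1 - S <= 1 by apply/andP; split; lra.
    by rewrite /r -/S (clampK S01) sqr_sqrtr//; case/andP: S01.
  exists C, r; split => //.
    by apply: slopes_ae sC _; apply: aeS dC => y dC; exists (r y).
  (* For e = 1 and e = -1 this bounds the increments of [prim w c o1] by those of [C]. It rests on
     [|f o1| <= r], which is the relaxed norm constraint. *)
  have key e : e ^+ 2 = 1 -> slopes 0 2 (fun y => C y + e * prim w c o1 y).
    move=> e1; apply: slopes_ae (slopesD sC (slopesZ e (sw c o1))) _.
    apply: aeS2 dC main => y dC [f df [[_ f1] rf]]; exists (r y + e * f o1).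
      by apply: has_derivD => //; exact: has_derivZ.
    have : (e * f o1) ^+ 2 <= r y ^+ 2.
      by move: f1; rewrite exprMn e1 mul1r rf /norm_ok (bigD1 o1)//=; lra.
    have /andP[ry0 ry1] := r01 y.
    rewrite -[r y ^+ 2]real_normK ?num_real// -[(e * _) ^+ 2]real_normK ?num_real//.
    rewrite ler_sqr ?nnegrE// (ger0_norm ry0) ler_norml => /andP[]; lra.
  move=> x y xy; have := key 1 (expr1n _ _) x y xy; have := key (-1).
  by rewrite sqrrN expr1n => /(_ erefl x y xy); rewrite ler_norml; lra.
have /choice[C /choice[r Cr]] := H.
pose w_ n : data := fun i => if i.1.2 == o1 then
  zigzag (prim w i.1.1 o1) (C i.1.1) z n i.2 else w i.
have wE n c o : prim (w_ n) c o =
    if o == o1 then zigzag (prim w c o1) (C c) z n else prim w c o.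
  by apply/funext => y; rewrite /prim /w_ /=; case: ifPn.
exists w_; split => [n|[[c o] y]]; last first.
  rewrite /w_ /=; have [->|_] := eqVneq o o1; last exact: cvg_cst.
  by have [C1 WC dC _] := Cr c; exact: (zigzag_cvg C1 WC zd).
split.
- move=> c o; rewrite wE; case: ifPn => // _; have [C1 WC dC _] := Cr c.
  by apply: zigzag0 => //; exact: w0.
- move=> c o; rewrite wE; case: ifPn => // _; have [C1 WC dC _] := Cr c.
  exact: zigzag_slopes.
- move=> c; have [C1 WC dC main] := Cr c.
  have dz : \forall y \ae mu, exists2 l,
      has_deriv (zigzag (prim w c o1) (C c) z n) y l & l ^+ 2 = r c y ^+ 2.
    exact: zigzag_deriv.
  apply: aeS2 main dz => y [f df [[fG f1] rf]] [l dl lr].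
  exists (fun o => if o == o1 then l else f o).
    by move=> o; rewrite wE; case: ifPn.
  split => //=.
  by rewrite sum_split lr rf subrK.
Qed.

End approximation.

(** * From Lagrangian data to solutions and back *)

Section flow.
Context {R : realType} {d : nat} (alpha delta : R).
Hypothesis delta0 : 0 < delta.
Local Notation mu := (@lebesgue_measure R).
Implicit Types (w : @data R d) (c : bool) (o : 'I_d.+1) (t s y : R).

(** D'Alembert's formula for the wave equation contained in [is_flow]. *)
Definition flow w t y : R :=
  (prim w true ord0 (y + t) + prim w false ord0 (y - t)) / 2.

(** The shifts [alpha] and [- alpha] cancel in the half sum, which leaves bounds that depend on
    [delta] alone. *)
Lemma flow_slopes w : is_data alpha delta false w ->
  forall t, slopes delta delta^-1 (flow w t).
Proof.
move=> /is_data_incrP[_ sw _] t x y xy; have xy0 : 0 <= y - x by rewrite subr_ge0.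
have := slopes_affine (sw true) t xy; have := slopes_affine (sw false) (- t) xy.
by rewrite /flow /shift_of; lra.
Qed.

Lemma flow_timeN w t s y : is_data alpha delta false w ->
  `|flow w t y - flow w s y| <= `|t - s|.
Proof.
move=> [_ sw _]; have h1 := slopes_lip (sw true ord0) (y + t) (y + s).
have h2 := slopes_lip (sw false ord0) (y - t) (y - s).
have e1 : y + t - (y + s) = t - s by ring.
have e2 : y - t - (y - s) = - (t - s) by ring.
rewrite /flow; rewrite e1 mul1r ler_norml in h1; rewrite e2 mul1r normrN ler_norml in h2.
by rewrite ler_norml; move/andP: h1 => [? ?]; move/andP: h2 => [? ?]; lra.
Qed.

(** The inverse of the flow, made total in [w]: the value [id] is a default for functions [w] whose
    flow is not invertible. *)
Definition label w t : R -> R :=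
  if pselect (exists g, cancel (flow w t) g /\ cancel g (flow w t)) is left e
  then projT1 (cid e) else id.

Lemma labelP w t : is_data alpha delta false w ->
  [/\ cancel (flow w t) (label w t), cancel (label w t) (flow w t) &
      slopes delta delta^-1 (label w t)].
Proof.
move=> dw; have [g [h1 h2]] := slopes_inverse delta0 (flow_slopes dw t).
rewrite invrK /label; case: pselect => [e|[]]; last by exists g.
case: (cid e) => /= g' [k1 k2] h3; split => // x y xy.
by rewrite -[x]h2 -[y]h2 !k1 !h2; exact: h3.
Qed.

Lemma label_lip w t s s' : is_data alpha delta false w ->
  `|label w t s - label w t s'| <= delta^-1 * `|s - s'|.
Proof.
move=> dw; have [_ _ sl] := labelP t dw; apply: slopes_lip; apply: slopes_le sl => //.
by rewrite (@le_trans _ _ 0)// ?oppr_le0 ?invr_ge0 ltW.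
Qed.

(** Null sets of labels correspond to null sets of positions because the flow, inverse of [label],
    is Lipschitz. *)
Lemma ae_label w t (P : R -> Prop) : is_data alpha delta false w ->
  (\forall y \ae mu, P y) -> \forall s \ae mu, P (label w t s).
Proof.
move=> dw; have [c1 c2 sl] := labelP t dw.
apply: (@ae_preimage _ _ (flow w t) delta^-1) => //.
  exact: slopes_measurable sl.
apply: slopes_lip; apply: slopes_le (flow_slopes dw t) => //.
by rewrite (@le_trans _ _ 0)// ?oppr_le0 ?invr_ge0 ltW.
Qed.

Lemma ae_shift t (P : R -> Prop) :
  (\forall y \ae mu, P y) -> \forall y \ae mu, P (y + t).
Proof.
apply: (@ae_preimage _ _ (fun y => y - t) 1).
- exact: measurable_funD.
- by move=> y; rewrite addrK.
- by move=> x y; rewrite opprD addrACA subrr addr0 mul1r.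
Qed.

Lemma ae_reflect t (P : R -> Prop) :
  (\forall y \ae mu, P y) -> \forall y \ae mu, P (t - y).
Proof.
apply: (@ae_preimage _ _ (fun y => t - y) 1).
- exact: measurable_funB.
- by move=> y; rewrite opprB addrC subrK.
- by move=> x y; rewrite mul1r distrC; rewrite (_ : t - y - (t - x) = x - y)//; ring.
Qed.

Definition arg c t y : R := if c then y + t else y - t.

Lemma ae_arg c t (P : R -> Prop) :
  (\forall y \ae mu, P y) -> \forall y \ae mu, P (arg c t y).
Proof. by rewrite /arg; case: c; exact: ae_shift. Qed.

(* [field w t y] is, at fixed [t], a primitive in the position [flow w t y] of
   the density [T U]. *)
Definition field w t y : state R d := mk_state y
  ((prim w true ord0 (y + t) - prim w false ord0 (y - t)) / 2)
  (\row_k ((prim w true (lift ord0 k) (y + t) + prim w false (lift ord0 k) (y - t)) / 2))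
  (\row_k ((prim w false (lift ord0 k) (y - t) - prim w true (lift ord0 k) (y + t)) / 2)).

Definition pot w t s : state R d := field w t (label w t s).

Lemma has_deriv_arg c t y (F : R -> R) l : has_deriv F (arg c t y) l ->
  has_deriv (fun x => F (arg c t x)) y l.
Proof.
move=> dF; rewrite -[l]mulr1; apply: (@has_deriv_comp _ F (arg c t)) => //.
rewrite -[1]addr0 /arg; case: c {dF}; apply: has_derivD;
  by [exact: has_deriv_id|exact: has_deriv_cst].
Qed.

Lemma has_deriv_label w t y l : is_data alpha delta false w ->
  has_deriv (flow w t) y l -> has_deriv (label w t) (flow w t y) l^-1.
Proof.
move=> dw dF; have [c1 c2 sl] := labelP t dw.
have /andP[dl _] := slopes_has_deriv (flow_slopes dw t) dF.
apply: is_derive_inverse dF _.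
- by exists 1 => //= x _; exact: c1.
- by exists 1 => //= x _; exact: (slopes_continuous (flow_slopes dw t)).
- by rewrite gt_eqF// (lt_le_trans delta0).
Qed.

(** Chain rule: in the label, the components of [field] have derivatives 1, v, eta, zeta and the
    flow has derivative tau, so composition with [label] divides each of them by tau. *)
Lemma has_deriv_pot w t (V : R -> state R d) : is_data alpha delta false w ->
  (\forall y \ae mu, forall c o,
      has_deriv (prim w c o) (arg c t y) (chi c o (V (flow w t y)))) ->
  \forall s \ae mu, forall i,
    has_deriv (fun s => pot w t s 0 i) s (T (V s) 0 i).
Proof.
move=> dw aV; have [c1 c2 sl] := labelP t dw.
apply: aeS (ae_label t dw aV) => s; rewrite c2; set y := label w t s => H.
have sy : s = flow w t y by rewrite /y c2.
have D c o := has_deriv_arg (H c o).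
have dflow : has_deriv (flow w t) y (tau (V s)).
  rewrite tau_chi mulrC; have := has_derivZ 2^-1 (has_derivD (D true ord0) (D false ord0)).
  by congr has_deriv; apply/funext => x; rewrite /flow mulrC.
have dlabel : has_deriv (label w t) s (tau (V s))^-1.
  by rewrite [X in has_deriv _ X]sy; exact: has_deriv_label.
have dcomp F l : has_deriv F y l ->
    has_deriv (fun s => F (label w t s)) s ((tau (V s))^-1 * l).
  by move=> dF; rewrite mulrC; exact: (@has_deriv_comp _ F (label w t)).
rewrite /T /pot /field.
apply: state_ind => [||k|k]; rewrite mxE.
- by under eq_fun do rewrite mk_state_h; rewrite mk_state_h mulr1.
- under eq_fun do rewrite mk_state_q mulrC; rewrite mk_state_q.
  apply: (dcomp (fun y => 2^-1 * (prim w true ord0 (y + t) - prim w false ord0 (y - t)))).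
  rewrite vel_chi mulrC; apply: has_derivZ; exact: has_derivB (D true ord0) (D false ord0).
- under eq_fun do rewrite mk_state_Y mxE mulrC; rewrite mk_state_Y.
  apply: (dcomp (fun y => 2^-1 * (prim w true (lift ord0 k) (y + t) + prim w false (lift ord0 k) (y - t)))).
  rewrite eta_chi mulrC; apply: has_derivZ; exact: has_derivD (D true _) (D false _).
- under eq_fun do rewrite mk_state_Z mxE mulrC; rewrite mk_state_Z.
  apply: (dcomp (fun y => 2^-1 * (prim w false (lift ord0 k) (y - t) - prim w true (lift ord0 k) (y + t)))).
  rewrite zeta_chi mulrC; apply: has_derivZ; exact: has_derivB (D false _) (D true _).
Qed.

Lemma pot_slopes w t i : is_data alpha delta false w ->
  slopes (- delta^-1) delta^-1 (fun s => pot w t s 0 i).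
Proof.
move=> dw s s' ss'; have [c1 c2 sl] := labelP t dw.
have /andP[h1 h2] := sl _ _ ss'; have [_ sw _] := dw.
have ss0 : 0 <= s' - s by rewrite subr_ge0.
have yy : label w t s <= label w t s'.
  by rewrite -subr_ge0 (le_trans _ h1)// mulr_ge0// ltW.
have H c o : - (label w t s' - label w t s) <=
    prim w c o (arg c t (label w t s')) - prim w c o (arg c t (label w t s)) <=
    label w t s' - label w t s.
  have := sw c o (arg c t (label w t s)) (arg c t (label w t s')).
  have -> : arg c t (label w t s') - arg c t (label w t s) = label w t s' - label w t s.
    by rewrite /arg; case: c; ring.
  by rewrite mulN1r mul1r; apply; rewrite /arg; case: c; rewrite lerD2r.
rewrite /pot /field; move: i; apply: state_ind => [||k|k].
- by rewrite !mk_state_h; lra.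
- by rewrite !mk_state_q; have := H true ord0; have := H false ord0; rewrite /arg; lra.
- by rewrite !mk_state_Y !mxE; have := H true (lift ord0 k); have := H false (lift ord0 k); rewrite /arg; lra.
- by rewrite !mk_state_Z !mxE; have := H true (lift ord0 k); have := H false (lift ord0 k); rewrite /arg; lra.
Qed.

(** The right side compares [w] and [w'] only at points determined by [w'], [t'] and [s]. Pointwise
    convergence of data to a fixed [w'] is therefore enough, with no uniformity in the position. *)
Lemma pot_dist w w' t t' s i : is_data alpha delta false w ->
  is_data alpha delta false w' ->
  `|pot w t s 0 i - pot w' t' s 0 i| <= (delta^-1 + 1) * (`|t - t'| +
    \sum_c \sum_o `|prim w c o (arg c t' (label w' t' s)) -
                     prim w' c o (arg c t' (label w' t' s))|).
Proof.
move=> dw dw'; set y' := label w' t' s; set y := label w t s.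
pose D c o := `|prim w c o (arg c t' y') - prim w' c o (arg c t' y')|.
rewrite -/(\sum_c \sum_o D c o); set e := `|t - t'| + _.
have D0 c o : 0 <= D c o by rewrite normr_ge0.
have De : forall c o, `|t - t'| + D c o <= e.
  move=> c o; rewrite lerD2l (bigD1 c)//= (bigD1 o)//= -addrA lerDl addr_ge0//.
    by apply: sumr_ge0.
  by apply: sumr_ge0 => c' _; apply: sumr_ge0.
have [_ sw _] := dw; have [c1 c2 sl] := labelP t dw; have [c1' c2' sl'] := labelP t' dw'.
have argE c a b r r' : arg c a r - arg c b r' = (r - r') + (if c then a - b else - (a - b)).
  by rewrite /arg; case: c; ring.
have lip c o r : `|prim w c o (arg c t r) - prim w' c o (arg c t' y')| <= `|r - y'| + e.
  have := slopes_lip (sw c o) (arg c t r) (arg c t' y'); rewrite argE mul1r => h.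
  have h2 : `|r - y' + (if c then t - t' else - (t - t'))| <= `|r - y'| + `|t - t'|.
    by apply: le_trans (ler_normD _ _) _; case: c {h}; rewrite ?normrN.
  rewrite -[prim w c o _](subrK (prim w c o (arg c t' y'))) -addrA.
  apply: le_trans (ler_normD _ _) _.
  by have := De c o; rewrite /D; lra.
(* The label [y'], whose position is [s] for [w'] at time [t'], is within [e] of [s] for [w] at time
   [t]; the Lipschitz bound on [label w t] turns this into a distance between labels. *)
have yy : `|y - y'| <= delta^-1 * e.
  apply: (@le_trans _ _ (delta^-1 * `|s - flow w t y'|)).
    by rewrite -{1}(c1 y'); exact: label_lip.
  rewrite ler_wpM2l ?invr_ge0 ?(ltW delta0)// -{1}(c2' s) -/y' /flow.
  have := lip true ord0 y'; have := lip false ord0 y'; rewrite /arg subrr normr0 add0r.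
  by rewrite !ler_norml; lra.
have lip' c o := le_trans (lip c o y) (_ : _ <= delta^-1 * e + e).
have {}lip' c o : - (delta^-1 * e + e) <= prim w c o (arg c t y) - prim w' c o (arg c t' y') <= delta^-1 * e + e.
  by rewrite -ler_norml lip'// lerD2r.
have e0 : 0 <= e by rewrite (le_trans _ (De true ord0))// addr_ge0.
rewrite mulrDl mul1r /pot /field -/y -/y' ler_norml; rewrite ler_norml in yy.
move: i; apply: state_ind => [||k|k].
- by rewrite !mk_state_h; lra.
- by rewrite !mk_state_q; have := lip' true ord0; have := lip' false ord0; rewrite /arg; lra.
- by rewrite !mk_state_Y !mxE; have := lip' true (lift ord0 k); have := lip' false (lift ord0 k); rewrite /arg; lra.
- by rewrite !mk_state_Z !mxE; have := lip' true (lift ord0 k); have := lip' false (lift ord0 k); rewrite /arg; lra.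
Qed.

End flow.

(** * Lipschitz maps and null sets of the plane *)

Section lip.
Context {R : realType}.
Local Notation mu := (@lebesgue_measure R).

Lemma lipschitz_ex (V : normedModType R) (f : V -> R^o) : lipschitz f ->
  exists2 L, 0 < L & forall x y, `|f x - f y| <= L * `|x - y|.
Proof.
move=> [M [_ HM]]; exists (`|M| + 1); first by rewrite ltr_pwDr.
have h : M < `|M| + 1 by rewrite (le_lt_trans (ler_norm _))// ltrDl.
by move=> x y; have := HM _ h (x, y) (conj Logic.I Logic.I).
Qed.

Lemma lipschitzI (V : normedModType R) (f : V -> R^o) L :
  (forall x y, `|f x - f y| <= L * `|x - y|) -> lipschitz f.
Proof.
move=> fL; exists L; split; first exact: num_real.
move=> M LM [x y] _ /=; apply: le_trans (fL x y) _.
by rewrite ler_wpM2r// ltW.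
Qed.

Lemma lip_slopes (f : R -> R) L : (forall x y, `|f x - f y| <= L * `|x - y|) ->
  slopes (- L) L f.
Proof.
move=> fL x y xy; have := fL y x; rewrite (ger0_norm (_ : 0 <= y - x)) ?subr_ge0//.
by rewrite ler_norml mulNr.
Qed.

Lemma borel_Lebesgue (g : R -> R) : measurable_fun setT g ->
  Lebesgue_measurable_fun g.
Proof.
move=> mg _ Y mY; rewrite setTI.
rewrite -[measurable]/((@wlength R idfun)^*%mu.-cara.-measurable).
apply: sub_caratheodory; rewrite -[X in measurable X]setTI; exact: mg.
Qed.

(** Fubini for null sets. The product measure integrates sections over the first variable, while
    lines with constant second variable are wanted; uniqueness of the product measure exchanges the
    order. *)
Lemma ae_prod_slice (P : R * R -> Prop) : (\forall p \ae (mu \x mu)%E, P p) ->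
  \forall y \ae mu, \forall t \ae mu, P (t, y).
Proof.
move=> [B [mB B0 PB]].
have : (\int[mu]_y (mu \o ysection B) y = 0)%E.
  rewrite -B0; apply/esym; apply: (@product_measure_unique _ _ _ _ R mu mu (mu \x^ mu)%E) => //.
  by move=> X Y mX mY; exact: product_measure2E.
move=> h.
have mB' := measurable_fun_ysection mu mB.
have : ae_eq mu setT (mu \o ysection B) (cst 0%E).
  apply/(ae_eq_integral_abs mu measurableT mB').
  rewrite -[RHS]h; apply: eq_integral => y _; rewrite gee0_abs//.
apply: aeS => y /(_ Logic.I) By; exists (ysection B y); split => //.
  exact: measurable_ysection.
by move=> t /= nP; apply/set_mem; rewrite mem_ysection; apply/mem_set; exact: PB.
Qed.

(** Tonelli: at fixed t, [arg c t] is a translation, so every section of the exceptional set is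
    null. *)
Lemma ae_prod_arg c (P : R -> Prop) : (\forall y \ae mu, P y) ->
  \forall p \ae (mu \x mu)%E, P (arg c p.1 p.2).
Proof.
move=> [B [mB B0 PB]].
pose f (p : R * R) : R := arg c p.1 p.2.
have mf : measurable_fun setT (f : measurableTypeR R * measurableTypeR R -> measurableTypeR R).
  rewrite /f /arg; case: c {f}; [apply: measurable_funD|apply: measurable_funB];
    by [exact: measurable_fst|exact: measurable_snd].
have mfB : measurable (f @^-1` B : set (measurableTypeR R * measurableTypeR R)).
  by rewrite -[X in measurable X]setTI; exact: mf.
exists (f @^-1` B); split => //; last by move=> p /= nP; exact: PB.
rewrite /product_measure1 integral0_eq// => t _ /=.
have : \forall y \ae mu, ~ B (arg c t y).
  apply: (@ae_arg _ c t (fun y => ~ B y)); exists B; split => // y /=; exact: contrapT.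
move=> [N [mN N0 BN]]; apply/eqP; rewrite eq_le measure_ge0 andbT -N0.
apply: (@le_measure _ _ _ mu); rewrite ?inE//; first exact: measurable_xsection.
by move=> y; rewrite /xsection /= inE => By; apply: BN => /=; apply.
Qed.

End lip.

(** * The correspondence between solutions and data *)

Section solutions.
Context {R : realType} {d : nat} (alpha delta : R).
Hypothesis delta0 : 0 < delta.
Local Notation mu := (@lebesgue_measure R).
Implicit Types (w : @data R d) (c : bool) (o : 'I_d.+1) (t s y : R).

Lemma chi_le1 exact c (f : 'I_d.+1 -> R) o :
  admissible alpha delta exact c f -> `|f o| <= 1.
Proof.
move=> [_ f1]; rewrite -(expr_le1 (n := 2))// real_normK ?num_real//.
have : \sum_o f o ^+ 2 <= 1 by move: f1; rewrite /norm_ok; case: exact => [->|].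
by apply: le_trans; rewrite (bigD1 o)//= lerDl sumr_ge0// => i _; rewrite sqr_ge0.
Qed.

Lemma flow_time_deriv w t y (l1 l2 : R) : has_deriv (prim w true ord0) (y + t) l1 ->
  has_deriv (prim w false ord0) (y - t) l2 ->
  has_deriv (fun t => flow w t y) t ((l1 - l2) / 2).
Proof.
move=> d1 d2.
have -> : (fun t => flow w t y) =
    fun t => 2^-1 * (prim w true ord0 (y + t) + prim w false ord0 (y - t)).
  by apply/funext => x; rewrite /flow mulrC.
rewrite mulrC; apply: has_derivZ; apply: has_derivD.
  rewrite -[l1]mulr1; apply: (@has_deriv_comp _ (prim w true ord0) (fun t => y + t)) => //.
  by rewrite -[1]add0r; apply: has_derivD; [exact: has_deriv_cst|exact: has_deriv_id].
rewrite -mulrN1; apply: (@has_deriv_comp _ (prim w false ord0) (fun t => y - t)) => //.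
by rewrite -[-1]add0r; apply: has_derivB; [exact: has_deriv_cst|exact: has_deriv_id].
Qed.

Lemma flow_space_deriv w t y (l : bool -> R) :
  (forall c, has_deriv (prim w c ord0) (arg c t y) (l c)) ->
  has_deriv (flow w t) y ((l true + l false) / 2).
Proof.
move=> dl.
have -> : flow w t =
    fun y => 2^-1 * (prim w true ord0 (arg true t y) + prim w false ord0 (arg false t y)).
  by apply/funext => x; rewrite /flow mulrC.
by rewrite mulrC; apply: has_derivZ; apply: has_derivD; exact: has_deriv_arg.
Qed.

(* The wave equation is integrated along vertical lines [y = cst], on almost all
   of which the flow has the prescribed time derivative for almost all times. *)
Lemma flow_unique exact (U0 : R -> state R d) xi w : is_flow U0 xi ->
  is_data alpha delta exact w ->
  (\forall y \ae mu, forall c o, has_deriv (prim w c o) y (chi c o (U0 (xi 0 y)))) ->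
  forall t, xi t = flow w t.
Proof.
move=> [[g [c1 c2 lx lg]] x0 dx0 lxi d2] dw df.
have {}dw : is_data alpha delta false w.
  by case: exact dw => //; exact: is_data_closed.
have [w0 sw _] := dw.
have [L L0 xiL] := lipschitz_ex lxi.
have sy t : slopes (- L) L (xi t).
  apply: lip_slopes => x y; have := xiL (t, x) (t, y).
  by rewrite /= prod_normE /= subrr normr0 (max_idPr (normr_ge0 _)).
have st y : slopes (- L) L (xi ^~ y).
  apply: lip_slopes => t s; have := xiL (t, y) (s, y).
  by rewrite /= prod_normE /= subrr normr0 (max_idPl (normr_ge0 _)).
have sft y : slopes (- 1) 1 (fun t => flow w t y).
  by apply: lip_slopes => t s; rewrite mul1r; exact: (flow_timeN _ _ _ dw).
have xi0 : xi 0 = flow w 0.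
  apply: (has_deriv_ae_eq (sy 0) (flow_slopes dw 0)); last first.
    by rewrite x0 /flow addr0 subr0 !w0 addr0 mul0r.
  apply: aeS2 dx0 df => y dx df; exists (tau (U0 (xi 0 y))) => //.
  rewrite tau_chi; apply: (@flow_space_deriv _ _ _ (fun c => chi c ord0 (U0 (xi 0 y)))) => c.
  by rewrite (_ : arg c 0 y = y)// /arg; case: (c); rewrite ?addr0 ?subr0.
have ae_y : \forall y \ae mu, forall t, xi t y = flow w t y.
  apply: aeS (ae_prod_slice d2) => y Hy t.
  suff : xi ^~ y = (fun t => flow w t y) by move=> /(congr1 (@^~ t)).
  apply: (has_deriv_ae_eq (st y) (sft y)); last by rewrite xi0.
  have h1 : \forall t \ae mu, forall c o,
      has_deriv (prim w c o) (y + t) (chi c o (U0 (xi 0 (y + t)))).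
    by have := ae_shift y df; apply: aeS => s; rewrite addrC.
  apply: aeS2 Hy (aeI h1 (ae_reflect y df)) => s [xt [xy [dxt dxy e1 e2]]] [dp dm].
  exists xt; first exact: dxt.
  have -> : xt = (chi true ord0 (U0 (xi 0 (y + s))) - chi false ord0 (U0 (xi 0 (y - s)))) / 2.
    by move: e1 e2; rewrite /= !chi0; lra.
  exact: flow_time_deriv (dp _ _) (dm _ _).
move=> t; apply: (slopes_ae_eq (sy t) (flow_slopes dw t)).
by apply: aeS ae_y => y.
Qed.

Lemma chi_borel (U0 : R -> state R d) c o :
  (forall i, Lebesgue_measurable_fun (fun s => U0 s 0 i)) ->
  exists2 h : R -> R, measurable_fun setT h & \forall s \ae mu, chi c o (U0 s) = h s.
Proof.
move=> mU; have [i [j [e E]]] := @chi_coord R d c o.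
have [hi mi Ei] := borel_version (mU i); have [hj mj Ej] := borel_version (mU j).
exists (fun s => hi s + e * hj s).
  by apply: measurable_funD => //; apply: measurable_funM.
by apply: aeS2 Ei Ej => s <- <-; exact: E.
Qed.

(** The datum consists of the primitives of the characteristic coordinates of [U0] composed with
    [xi 0]. By uniqueness [xi] is the flow of this datum, and then the defining relations of [U] are
    the hypothesis of [has_deriv_pot]. *)
Lemma solution_data exact (U : R -> R -> state R d) :
  solutions_in alpha delta (target exact) U ->
  exists2 w, is_data alpha delta exact w & forall t, \forall s \ae mu, forall i,
    has_deriv (fun s => pot w t s 0 i) s (T (U t s) 0 i).
Proof.
move=> [[U0 [mU0 gU0 [xi fl rel]]] vU].
have [[g [c1 c2 lx lg]] x0 dx0 lxi d2] := fl.
have [L L0 gL] := lipschitz_ex lg; have [L' L'0 xL] := lipschitz_ex lx.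
have mxi : measurable_fun setT (xi 0) by exact: slopes_measurable (lip_slopes xL).
have pre (P : R -> Prop) : (\forall s \ae mu, P s) -> \forall y \ae mu, P (xi 0 y).
  exact: (ae_preimage mxi c1 gL).
(* The constraint is assumed on [U]; at time 0 the defining relations identify the characteristic
   coordinates of [U] and of [U0]. *)
have adm : \forall y \ae mu, forall c,
    admissible alpha delta exact c (fun o => chi c o (U0 (xi 0 y))).
  apply: aeS2 (pre _ (vU 0)) (rel 0) => y /target_chi H /chi_relP E c.
  have := H c; congr (admissible _ _ _ _ _); apply/funext => o.
  by rewrite E addr0 subr0; case: ifP.
have Hf c o : exists f : R -> R, [/\ measurable_fun setT f, forall y, `|f y| <= 1 &
    \forall y \ae mu, chi c o (U0 (xi 0 y)) = f y].
  have [h mh Eh] := chi_borel c o mU0.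
  (* Admissible coordinates are at most 1 in absolute value, so the clamp changes nothing almost
     everywhere. *)
  exists (fun y => clamp (-1) 1 (h (xi 0 y))); split.
  - by apply: measurable_clamp; exact: (measurableT_comp mh mxi).
  - by move=> y; rewrite ler_norml clamp_in// (@le_trans _ _ 0)// oppr_le0.
  - apply: aeS2 adm (pre _ Eh) => y /(_ c) H <-; rewrite clampK// -ler_norml.
    exact: chi_le1 H.
have /choice[F HF] (co : bool * 'I_d.+1) : exists F, [/\ F 0 = 0, slopes (- 1) 1 F &
    \forall y \ae mu, has_deriv F y (chi co.1 co.2 (U0 (xi 0 y)))].
  have [f [mf f1 Ef]] := Hf co.1 co.2; have [F [F0 sF _ dF]] := primitive_exists mf f1.
  by exists F; split => //; apply: aeS2 dF Ef => y + ->.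
pose w : @data R d := fun i => F i.1 i.2.
have dF : \forall y \ae mu, forall c o, has_deriv (prim w c o) y (chi c o (U0 (xi 0 y))).
  have : \forall y \ae mu, forall co, has_deriv (F co) y (chi co.1 co.2 (U0 (xi 0 y))).
    by apply: ae_fin => co; have [] := HF co.
  by apply: aeS => y H c o; exact: H (c, o).
have dw : is_data alpha delta exact w.
  split => [c o|c o|c]; [by have [] := HF (c, o)|by have [] := HF (c, o)|].
  apply: aeS2 adm dF => y H1 H2; exists (fun o => chi c o (U0 (xi 0 y))) => //.
have dw' : is_data alpha delta false w.
  by case: exact dw {vU adm} => //; exact: is_data_closed.
exists w => // t; apply: (has_deriv_pot delta0 dw').
have xiE := flow_unique fl dw dF.
have H1 : \forall y \ae mu, forall c o,
    has_deriv (prim w c o) (arg c t y) (chi c o (U0 (xi 0 (arg c t y)))).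
  have := ae_fin (fun c => ae_arg c t dF); apply: aeS => y H c o; exact: H.
apply: aeS2 (rel t) H1 => y /chi_relP E H c o.
rewrite -xiE E; have := H c o; rewrite /arg; by case: (c).
Qed.

(** Measurable densities of the primitives, transported along characteristics, serve as
    characteristic coordinates of [U], and [flow w] is the required flow. *)
Lemma data_solution exact w : is_data alpha delta exact w ->
  exists2 U : R -> R -> state R d, solutions_in alpha delta (target exact) U &
  forall t, \forall s \ae mu, forall i,
    has_deriv (fun s => pot w t s 0 i) s (T (U t s) 0 i).
Proof.
move=> dwe; have [w0 sw aw] := dwe.
have dw : is_data alpha delta false w.
  by case: exact dwe {aw} => //; exact: is_data_closed.
have Hu (co : bool * 'I_d.+1) : exists u : R -> R, measurable_fun setT u /\
    \forall y \ae mu, has_deriv (prim w co.1 co.2) y (u y).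
  by have [u [mu_ _ _ du]] := lipschitz_density (sw co.1 co.2); exists u.
have {Hu}/choice[u0 Hu] := Hu.
pose u c o := u0 (c, o).
have mu_ c o : measurable_fun setT (u c o) by have [] := Hu (c, o).
have du : \forall y \ae mu, forall c o, has_deriv (prim w c o) y (u c o y).
  have : \forall y \ae mu, forall co, has_deriv (prim w co.1 co.2) y (u0 co y).
    by apply: ae_fin => co; have [] := Hu co.
  by apply: aeS => y H c o; exact: H (c, o).
have adm : \forall y \ae mu, forall c, admissible alpha delta exact c (fun o => u c o y).
  apply: aeS2 (ae_fin aw) du => y H1 H2 c; have [f df af] := H1 c.
  have := af; congr (admissible _ _ _ _ _); apply/funext => o.
  exact: has_deriv_unique (df o) (H2 c o).
have admA t : \forall y \ae mu, forall c,
    admissible alpha delta exact c (fun o => u c o (arg c t y)).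
  by have := ae_fin (fun c => ae_arg c t adm); apply: aeS => y H c; exact: H.
pose U t s := unchi (fun c o => u c o (arg c t (label w t s))).
pose U0 s := unchi (fun c o => u c o (label w 0 s)).
have L0 t := labelP delta0 t dw.
have mlab : measurable_fun setT (label w 0).
  by have [_ _ sl] := L0 0; exact: slopes_measurable sl.
have chiU0 c o y : chi c o (U0 (flow w 0 y)) = u c o y.
  by rewrite /U0 chi_unchi; have [-> _ _] := L0 0.
have chiU c o t y : chi c o (U t (flow w t y)) = u c o (arg c t y).
  by rewrite /U chi_unchi; have [-> _ _] := L0 t.
have vU t : \forall s \ae mu, (target exact `&` G alpha delta) (U t s).
  apply: aeS (ae_label delta0 t dw (admA t)) => s H; apply/target_chi => c.
  have := H c; congr (admissible _ _ _ _ _); apply/funext => o.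
  by rewrite /U chi_unchi.
exists U; last first.
  move=> t; apply: (has_deriv_pot delta0 dw).
  have := ae_fin (fun c => ae_arg c t du); apply: aeS => y H c o.
  by rewrite chiU; exact: H.
split => //; exists U0; split.
- have mul c o : measurable_fun setT (fun s => u c o (label w 0 s)).
    exact: (measurableT_comp (mu_ c o) mlab).
  move=> i; apply: borel_Lebesgue; move: i; apply: state_ind => [||k|k].
  + under eq_fun do rewrite mk_state_h; apply: measurable_funM => //.
    by apply: measurable_funD; exact: mul.
  + under eq_fun do rewrite mk_state_q; apply: measurable_funM => //.
    by apply: measurable_funB; exact: mul.
  + under eq_fun do rewrite mk_state_Y mxE; apply: measurable_funM => //.
    by apply: measurable_funD; exact: mul.
  + under eq_fun do rewrite mk_state_Z mxE; apply: measurable_funM => //.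
    by apply: measurable_funB; exact: mul.
- apply: aeS (vU 0) => s [_]; congr (G _ _ _).
  rewrite /U /U0; congr unchi; apply/funext => c; apply/funext => o.
  by rewrite /arg; case: c; rewrite ?addr0 ?subr0.
- exists (flow w); last first.
    by move=> t; apply: aeW => y /=; apply/chi_relP => c o; rewrite chiU /arg;
      case: c; rewrite chiU0.
  have [c1 c2 sl] := L0 0; have d'0 : 0 < delta^-1 by rewrite invr_gt0.
  have Ndd : - delta^-1 <= delta by rewrite (@le_trans _ _ 0) ?oppr_le0 ?ltW.
  have lipf t := slopes_lip (slopes_le Ndd (lexx _) (flow_slopes dw t)).
  split.
  + exists (label w 0); split => //.
      exact: (@lipschitzI R R^o (flow w 0) delta^-1).
    exact: (@lipschitzI R R^o (label w 0) delta^-1 (slopes_lip (slopes_le Ndd (lexx _) sl))).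
  + by rewrite /flow addr0 subr0 !w0 addr0 mul0r.
  + apply: aeS du => y H; rewrite tau_chi.
    apply: (@flow_space_deriv w 0 y (fun c => chi c ord0 (U0 (flow w 0 y)))) => c.
    by rewrite chiU0 (_ : arg c 0 y = y)// /arg; case: (c); rewrite ?addr0 ?subr0.
  + apply: (@lipschitzI R (R * R)%type _ (1 + delta^-1)) => -[t y] [s x] /=.
    rewrite -[flow w t y](subrK (flow w s y)) -addrA.
    apply: le_trans (ler_normD _ _) _.
    rewrite mulrDl mul1r lerD//.
      by apply: le_trans (flow_timeN _ _ _ dw) _; rewrite prod_normE /= le_max lexx.
    apply: le_trans (lipf _ _ _) _; rewrite ler_wpM2l ?(ltW d'0)//.
    by rewrite prod_normE /= le_max lexx orbT.
  + have [A1 A2] := (ae_prod_arg true du, ae_prod_arg false du).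
    (* The equations hold wherever the primitives are differentiable at both y + t and y - t, that
       is, off the union of two null sets of the plane. *)
    have /= := negligibleU A1 A2; apply: negligibleS => -[t y] /= nH.
    apply: contrapT => /not_orP[/contrapT H1 /contrapT H2]; apply: nH.
    exists ((u true ord0 (y + t) - u false ord0 (y - t)) / 2),
           ((u true ord0 (y + t) + u false ord0 (y - t)) / 2).
    split.
    * exact: flow_time_deriv (H1 true ord0) (H2 false ord0).
    * apply: (@flow_space_deriv w t y (fun c => u c ord0 (arg c t y))) => c.
      by case: c; [exact: H1|exact: H2].
    * have := chiU0 true ord0 (y + t); have := chiU0 true ord0 (y + t).
      by rewrite chi0 => e _; rewrite [RHS]addrC e; field.
    * have := chiU0 false ord0 (y - t); rewrite chi0 /= => e.
      by rewrite -[RHS]opprB e; field.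
Qed.

End solutions.

(** * The weak-star topology *)

Section Linfty.
Context {R : realType}.
Local Notation mu := (@lebesgue_measure R).
Implicit Types (u v : Linfty R).

Let mu_gt0 : (0 < mu [set: R])%E.
Proof.
rewrite (_ : [set: R] = [set` `]-oo, +oo[]); last by rewrite set_itvE.
by rewrite lebesgue_measure_itv/= ltry.
Qed.

Lemma Linfty_measurable u : measurable_fun setT (u : R -> R).
Proof. exact: (@measurable_funPT _ _ _ _ (repr (LebesgueSpace.sort u))). Qed.

Lemma Linfty_bounded u : exists M : R, \forall s \ae mu, `|u s| <= M.
Proof.
have : finite_norm mu +oo%E (u : R -> R).
  exact: (@Lebesgue_finite _ _ _ _ _ _ (u : LspaceType _ _)).
rewrite /finite_norm unlock /Lnorm mu_gt0.
set E := ess_sup _ _ => Eoo.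
have E0 : (0 <= E)%E.
  apply: ess_sup_gee => //; apply: aeW => x /=; by rewrite lee_fin normr_ge0.
exists (fine E); apply: aeS (ess_sup_ge mu (abse \o (EFin \o (u : R -> R)))) => s.
by rewrite -/E -[E in (_ <= E)%E -> _]fineK ?ge0_fin_numE//= lee_fin.
Qed.

Lemma Linfty_eq u v : (\forall s \ae mu, u s = v s) -> u = v.
Proof.
move=> uv.
have E : LebesgueSpace.sort u = LebesgueSpace.sort v.
  apply/eqP; rewrite -[LebesgueSpace.sort u]reprK -[LebesgueSpace.sort v]reprK.
  by apply/ae_eqP; apply: aeS uv => s + _.
case: u v {uv} E => u [[pu]] [v [[pv]]] /= E.
by rewrite E in pu *; rewrite (Prop_irrelevance pu pv).
Qed.

Lemma Linfty_mk (f : R -> R) (L : R) : measurable_fun setT f ->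
  (forall s, `|f s| <= L) -> exists u : Linfty R, \forall s \ae mu, u s = f s.
Proof.
move=> mf fL.
pose f0 : {mfun measurableTypeR R >-> measurableTypeR R} :=
  HB.pack f (isMeasurableFun.Build _ _ (measurableTypeR R) (measurableTypeR R) f mf).
pose q : aeEqMfun _ mu := (\pi_(aeEqMfun _ mu) f0)%qT.
have qf : \forall s \ae mu, (q : R -> R) s = f s.
  have /eqP : (repr q = f0 %[mod aeEqMfun _ mu])%qT by rewrite reprK.
  rewrite eqmodE => /asboolP.
  by apply: aeS => s /(_ Logic.I).
have fq : finite_norm mu +oo%E (q : R -> R).
  rewrite /finite_norm unlock /Lnorm mu_gt0.
  apply: (@le_lt_trans _ _ L%:E); last exact: ltry.
  by apply/ess_supP; apply: aeS qf => s /= ->; rewrite lee_fin.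
pose u : LspaceType mu (leey 1) := HB.pack q (isFinLebesgue.Build _ _ _ _ _ _ q fq).
by exists u.
Qed.

End Linfty.

Section convergence.

Lemma ptws_cvg {I X : Type} {V : topologicalType} (F : set_system X) (f : X -> {ptws I -> V})
  (g : {ptws I -> V}) : Filter F ->
  (forall i, f x i @[x --> F] --> g i) -> f @ F --> g.
Proof.
move=> FF H; apply/cvg_sup => i U [V0 [[W oW <-] Wg WU]].
apply: (filterS WU); apply: H; exact: open_nbhs_nbhs.
Qed.

Lemma initial_cvg {X : Type} {S : choiceType} {V : topologicalType} (k : S -> V)
  (F : set_system X) (f : X -> initial_topology k) (g : initial_topology k) : Filter F ->
  k (f x) @[x --> F] --> k g -> f @ F --> g.
Proof.
move=> FF H U [_ [[W oW <-] Wg WU]]; apply: (filterS WU); apply: H.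
exact: open_nbhs_nbhs.
Qed.

Lemma weakstar_cvg {R : realType} {n : nat} {X : Type} (F : set_system X)
  (f : X -> Linfty_weakstar R n) (u : Linfty_weakstar R n) : Filter F ->
  (forall i, pairing (f x) i @[x --> F] --> pairing u i) -> f @ F --> u.
Proof. by move=> FF H; apply: initial_cvg; exact: ptws_cvg. Qed.

(** Convergence jointly in time and along [F] near each instant becomes uniform on compact sets by
    the covering form of compactness. *)
Lemma C0_cvg {R : realType} {n : nat} {X : Type} (F : set_system X)
  (f : X -> C0_weakstar R n) (u : C0_weakstar R n) : Filter F ->
  (forall t i, forall e : R, 0 < e -> \forall s \near t & x \near F, 
     `|pairing ((u : continuousType R (Linfty_weakstar R n)) t) i - 
       pairing ((f x : continuousType R (Linfty_weakstar R n)) s) i| < e) -> f @ F --> u.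
Proof.
move=> FF H; apply: initial_cvg; apply/fam_cvgP => K cK.
move=> P /uniform_nbhs[E [entE EP]]; apply: (filterS EP).
pose ev (u : C0_weakstar R n) t := (u : continuousType R (Linfty_weakstar R n)) t.
have : forall t, K t -> \forall s \near t & x \near F, E (ev u s, ev (f x) s).
  move=> t Kt.
  (* The hypothesis compares [f x] at [s] with [u] at [t]; continuity of [u] replaces [u t] by
     [u s], at the price of halving the entourage. *)
  have h1 : ev u s @[s --> t] --> ev u t by exact: cts_fun.
  have h2 : ev (f p.2) p.1 @[p --> (nbhs t, F)] --> ev u t.
    apply: weakstar_cvg => i; apply/cvgrPdist_lt => e e0; exact: H.
  have [E' entE' EE'] := entourage_split_ex entE.
  have /cvg_entourageP /(_ _ (entourage_inv entE')) h1' := h1.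
  have /cvg_entourageP /(_ _ entE') h2' := h2.
  have h1'' : \forall p \near (nbhs t, F), (E'^-1)%relation (ev u t, ev u p.1).
    exists ([set s | (E'^-1)%relation (ev u t, ev u s)], setT).
      by split; [exact: h1'|exact: filterT].
    by move=> [s x] [].
  apply: filterS2 h1'' h2' => -[s x] /= e1 e2; apply: EE'; by exists (ev u t).
by move/compact_near_coveringP : cK; apply.
Qed.

Lemma C0_eval {R : realType} {n : nat} t i : continuous (fun u : C0_weakstar R n =>
  pairing ((u : continuousType R (Linfty_weakstar R n)) t) i).
Proof.
move=> u.
pose V := {family compact, R -> Linfty_weakstar R n}.
pose k : C0_weakstar R n -> V := (id : continuousType R (Linfty_weakstar R n) -> V).
have h1 : k @ u --> k u by exact: initial_continuous.
have h2 : (k u') t @[u' --> u] --> k u t.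
  have FF : Filter (k @ nbhs u) by apply: fmap_filter; exact: nbhs_filter.
  rewrite -[X in X --> _]/((fun g : V => g t) @ (k @ nbhs u)).
  rewrite -(uniform_set1 (k u) t FF).
  move: (fam_cvgP compact (k u) FF).1 => /(_ h1); apply; exact: compact_set1.
have h3 : continuous (@pairing R n : Linfty_weakstar R n -> _) by exact: initial_continuous.
have h4 := @proj_continuous ('I_n * L1 R)%type (fun=> R) i.
have h5 : pairing (k u' t) @[u' --> u] --> pairing (k u t) := cvg_comp _ _ h2 (h3 _).
exact: cvg_comp _ _ h5 (h4 _).
Qed.

End convergence.

(** * Pairings of bounded densities with integrable functions *)

Section bounded_pairing.
Context {R : realType}.
Local Notation mu := (@lebesgue_measure R).
Implicit Types (v f g h : R -> R).

Lemma L1fun_mul v f K : measurable_fun setT v -> (\forall s \ae mu, `|v s| <= K) ->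
  L1fun f -> L1fun (fun s => v s * f s).
Proof.
move=> mv vK fi; have mf : measurable_fun setT f.
  by apply/measurable_EFinP; exact: measurable_int fi.
apply/integrableP; split.
  by apply/measurable_EFinP; exact: measurable_funM.
have := integrableP _ _ _ (L1funZ K fi) => -[_].
apply: le_lt_trans; apply: ae_ge0_le_integral => //.
- by apply: measurableT_comp => //; apply/measurable_EFinP; exact: measurable_funM.
- by apply: measurableT_comp => //; apply/measurable_EFinP; exact: measurable_funM.
- apply: aeS vK => s vs _; rewrite /= lee_fin !normrM ler_wpM2r//.
  by rewrite (le_trans vs)// ler_norm.
Qed.

Lemma pairing_lip v f h (K e : R) : measurable_fun setT v -> (\forall s \ae mu, `|v s| <= K) ->
  0 <= K -> L1fun f -> L1fun h -> (\int[mu]_s `|(f s - h s)%:E| <= e%:E)%E ->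
  `|\int[mu]_s (v s * f s) - \int[mu]_s (v s * h s)| <= K * e.
Proof.
move=> mv vK K0 fi hi fh.
have ghi : L1fun (fun s => f s - h s).
  have := L1funD fi (L1funZ (-1) hi); congr L1fun; apply/funext => s; by rewrite mulN1r.
rewrite -RintegralB//; last 2 first.
- exact: L1fun_mul mv vK fi.
- exact: L1fun_mul mv vK hi.
under eq_Rintegral do rewrite -mulrBr.
have vi := L1fun_mul mv vK ghi.
apply: (le_trans (le_normr_Rintegral _ vi)) => //.
rewrite -lee_fin /Rintegral fineK; last first.
  by rewrite ge0_fin_numE; [have /integrableP[] := vi|exact: integral_ge0].
rewrite EFinM; apply: (@le_trans _ _ (K%:E * \int[mu]_s `|(f s - h s)%:E|)%E); last first.
  by rewrite lee_wpmul2l// lee_fin.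
have mfh : measurable_fun setT (fun s => `|(f s - h s)%:E|%E).
  by apply: measurableT_comp => //; exact: measurable_int ghi.
rewrite -ge0_integralZl//.
apply: ae_ge0_le_integral => //.
- apply/measurable_EFinP; apply: measurableT_comp => //; apply/measurable_EFinP.
  exact: measurable_int vi.
- by move=> s _; rewrite mule_ge0// lee_fin.
- by apply: measurable_funeM.
- apply: aeS vK => s vs _; rewrite /= -EFinM lee_fin normrM ler_wpM2r//.
Qed.

Lemma Rintegral_mul_indic v (A : set (measurableTypeR R)) : measurable A ->
  \int[mu]_s (v s * \1_A s) = \int[mu]_(s in A) v s.
Proof.
move=> mA; rewrite [RHS]Rintegral_mkcond; apply: eq_Rintegral => s _.
by rewrite patchE indicE; case: ifPn => _; rewrite ?mulr1 ?mulr0.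
Qed.

Lemma L1_fun (g : L1 R) : L1fun (g : R -> R).
Proof. by apply/Lfun1_integrable; exact: LfunP. Qed.

Lemma L1_indic (a b : R) : exists g : L1 R, (g : R -> R) = \1_(`]a, b]%classic : set R).
Proof.
have H : (\1_(`]a, b]%classic : set R) : R -> R) \in Lfun mu 1.
  apply/Lfun1_integrable; apply: L1fun_indic; first exact: measurable_itv.
  rewrite /= lebesgue_measure_itv/=.
  by case: ifPn => // _; rewrite -EFinB ltry.
by exists (Lfun_Sub (lexx 1%E) H).
Qed.

End bounded_pairing.

Section potential.
Context {R : realType} {d : nat} (alpha delta : R).
Hypothesis delta0 : 0 < delta.
Local Notation mu := (@lebesgue_measure R).
Local Notation n := (1 + 1 + d + d)%N.
Implicit Types (w : @data R d) (v : Linfty_vec R n) (t s : R).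
Local Notation is_data := (is_data alpha delta).

Definition pot_density w t v : Prop := forall i, \forall s \ae mu,
  has_deriv (fun s => pot w t s 0 i) s (v i s).

Lemma pot_density_exists w t : is_data false w -> exists v, pot_density w t v.
Proof.
move=> dw.
suff : forall i, exists u : Linfty R, \forall s \ae mu,
    has_deriv (fun s => pot w t s 0 i) s (u s).
  by move=> /choice[v H]; exists v.
move=> i; have [u [mf uK _ du]] := lipschitz_density (pot_slopes delta0 t i dw).
have [u' uu'] := Linfty_mk mf uK; exists u'.
by apply: aeS2 uu' du => s ->.
Qed.

Lemma pot_density_le w t v i : is_data false w -> pot_density w t v ->
  \forall s \ae mu, `|v i s| <= delta^-1.
Proof.
move=> dw /(_ i); apply: aeS => s dv; rewrite ler_norml.
exact: slopes_has_deriv (pot_slopes delta0 t i dw) dv.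
Qed.

Lemma pot_density_itv w t v i a b : is_data false w -> pot_density w t v -> a <= b ->
  \int[mu]_s (v i s * \1_(`]a, b]%classic : set R) s) = pot w t b 0 i - pot w t a 0 i.
Proof.
move=> dw dv ab; rewrite Rintegral_mul_indic; last exact: measurable_itv.
by apply: (Rintegral_slopes (Linfty_measurable (v i)) (pot_slopes delta0 t i dw) (dv i)).
Qed.

Lemma pot_cvg {X : Type} (F : set_system X) {FF : Filter F} (w_ : X -> @data R d)
    (t_ : X -> R) w t s i : is_data false w ->
  (\forall x \near F, is_data false (w_ x)) -> t_ @ F --> t ->
  (forall j, w_ x j @[x --> F] --> w j) ->
  pot (w_ x) (t_ x) s 0 i @[x --> F] --> pot w t s 0 i.
Proof.
move=> dw dw_ tt ww.
apply/cvgrPdist_le => e; rewrite /= => e0.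
pose y c := arg c t (label w t s).
pose E x := (delta^-1 + 1) * (`|t_ x - t| + \sum_c \sum_o `|prim (w_ x) c o (y c) - prim w c o (y c)|).
have E0 : E x @[x --> F] --> 0.
  have N (f : X -> R) l : f x @[x --> F] --> l -> `|f x - l| @[x --> F] --> (0 : R).
    by move=> fl; rewrite -[0](normr0 R) -(subrr l); apply: cvg_norm; apply: cvgB => //; exact: cvg_cst.
  rewrite -[0](mulr0 (delta^-1 + 1)); apply: cvgM; first exact: cvg_cst.
  rewrite -[X in _ --> X]addr0; apply: cvgD; first exact: N.
  have sum0 (I : finType) (f : I -> X -> R) : (forall i, f i x @[x --> F] --> (0 : R)) ->
      \sum_i f i x @[x --> F] --> (0 : R).
    move=> fi; elim: (index_enum I) => [|j r IH].
      by under eq_fun do rewrite big_nil; exact: cvg_cst.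
    under eq_fun do rewrite big_cons.
    by have H := cvgD (fi j) IH; rewrite addr0 in H; exact: H.
  by apply: (@sum0 _) => c; apply: (@sum0 _) => o; apply: N; exact: ww.
move/cvgrPdist_le : E0 => /(_ _ e0) Q; apply: filterS2 dw_ Q => x dwx; rewrite sub0r normrN => /(le_trans (ler_norm _)).
by apply: le_trans; rewrite distrC; have := pot_dist delta0 (t_ x) t s i dwx dw; rewrite /E.
Qed.

(** On indicators of intervals the pairings are increments of [pot], which converge; the bound
    1/delta common to all densities extends this to L1. Since the times [t_] also vary, the lemma
    yields both continuity in time and convergence of solutions. *)
Lemma pairing_cvg {X : Type} (F : set_system X) {FF : Filter F} (w_ : X -> @data R d)
    (t_ : X -> R) (v_ : X -> Linfty_vec R n) w t v : is_data false w -> pot_density w t v ->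
  (\forall x \near F, is_data false (w_ x) /\ pot_density (w_ x) (t_ x) (v_ x)) ->
  t_ @ F --> t -> (forall j, w_ x j @[x --> F] --> w j) ->
  forall i, pairing (v_ x) i @[x --> F] --> pairing v i.
Proof.
move=> dw dv D tt ww [i g]; rewrite /pairing /=.
have dw_ : \forall x \near F, is_data false (w_ x) by apply: filterS D => x [].
have K0 : 0 <= delta^-1 by rewrite invr_ge0 ltW.
have vi f (u : Linfty_vec R n) w' t' : L1fun f -> is_data false w' -> pot_density w' t' u ->
    L1fun (fun s => u i s * f s).
  move=> fi dw' du; exact: L1fun_mul (Linfty_measurable _) (pot_density_le i dw' du) fi.
pose P (f : R -> R) := \int[mu]_s (v_ x i s * f s) @[x --> F] --> \int[mu]_s (v i s * f s).
suff : P g by [].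
apply: (@L1_ind R P); last exact: L1_fun.
- move=> a b ab; rewrite /P (pot_density_itv i dw dv ab).
  apply: (@cvg_trans _ (pot (w_ x) (t_ x) b 0 i - pot (w_ x) (t_ x) a 0 i @[x --> F])).
    apply: near_eq_cvg; apply: filterS D => x [dx vx].
    by rewrite (pot_density_itv i dx vx ab).
  by apply: cvgB; exact: pot_cvg.
- move=> f h fi hi Pf Ph; rewrite /P.
  under eq_Rintegral do rewrite mulrDr.
  rewrite RintegralD//; [|exact: vi dw dv|exact: vi dw dv].
  apply: cvg_trans (cvgD Pf Ph); apply: near_eq_cvg; apply: filterS D => x [dx vx] /=.
  under [RHS]eq_Rintegral do rewrite mulrDr.
  by rewrite RintegralD//; exact: vi dx vx.
- move=> c f fi Pf; rewrite /P.
  have Z (u : Linfty_vec R n) w' t' : is_data false w' -> pot_density w' t' u ->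
      \int[mu]_s (u i s * (c * f s)) = c * \int[mu]_s (u i s * f s).
    move=> dw' du; rewrite -RintegralZl//; last exact: vi dw' du.
    by apply: eq_Rintegral => s _; rewrite mulrCA.
  rewrite (Z _ _ _ dw dv); apply: cvg_trans (cvgM (cvg_cst c) Pf); apply: near_eq_cvg.
  by apply: filterS D => x [dx vx] /=; rewrite (Z _ _ _ dx vx).
- move=> f fi H; apply/cvgrPdist_le => e e0.
  (* Densities are bounded by 1/delta, so replacing [f] by [h] costs at most [e / 3] in each of the
     two pairings; the last third is for the convergence at [h]. *)
  have e1 : 0 < e / 3 * delta by rewrite !mulr_gt0 ?invr_gt0.
  have [h [hi Ph fh]] := H _ e1.
  have L (u : Linfty_vec R n) w' t' : is_data false w' -> pot_density w' t' u ->
      `|\int[mu]_s (u i s * f s) - \int[mu]_s (u i s * h s)| <= e / 3.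
    move=> dw' du; rewrite (le_trans (pairing_lip (Linfty_measurable _) (pot_density_le i dw' du) K0 fi hi fh))//.
    by rewrite mulrCA mulVf ?mulr1// gt_eqF.
  have e3 : 0 < e / 3 by rewrite divr_gt0.
  move/cvgrPdist_le : Ph => /(_ _ e3) Q; apply: filterS2 D Q => x [dx vx].
  have := L _ _ _ dw dv; have := L _ _ _ dx vx; rewrite !ler_norml; lra.
Qed.

End potential.

(** * The map from data to solutions; compactness and closure *)

Section solution_map.
Context {R : realType} {d : nat} (alpha delta : R).
Hypothesis delta0 : 0 < delta.
Local Notation mu := (@lebesgue_measure R).
Local Notation n := (1 + 1 + d + d)%N.
Implicit Types (w : @data R d) (t s : R) (u : C0_weakstar R n).
Local Notation is_data := (is_data alpha delta).
Local Notation pot_density := (@pot_density R d).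

Definition at_time u t : Linfty_vec R n :=
  (u : continuousType R (Linfty_weakstar R n)) t.

Lemma C0_eq u v : (forall t i, \forall s \ae mu, at_time u t i s = at_time v t i s) ->
  u = v.
Proof.
move=> uv; apply/(@continuousEP R (Linfty_weakstar R n)) => t.
by apply/funext => i; apply: Linfty_eq; exact: uv.
Qed.

Definition data_map w u : Prop := forall t, pot_density w t (at_time u t).

Lemma data_map_exists w : is_data false w -> exists u, data_map w u.
Proof.
move=> dw; have /choice[v dv] t := pot_density_exists delta0 t dw.
have cv : continuous (v : R -> Linfty_weakstar R n).
  move=> t; apply: weakstar_cvg.
  apply: (pairing_cvg delta0 (w_ := fun=> w) (t_ := id) dw (dv t)).
  - exact: nearW.
  - exact: cvg_id.
  - by move=> j; exact: cvg_cst.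
by exists (HB.pack (v : R -> Linfty_weakstar R n) (isContinuous.Build _ _ _ cv)
  : continuousType R (Linfty_weakstar R n)).
Qed.

Lemma data_map_fun w u v : data_map w u -> data_map w v -> u = v.
Proof.
move=> wu wv; apply: C0_eq => t i; apply: aeS2 (wu t i) (wv t i) => s.
exact: has_deriv_unique.
Qed.

(** [pairing_cvg] is applied along the product of the neighbourhoods of t with [F], which is the
    joint convergence required by [C0_cvg]. *)
Lemma data_map_cvg {X : Type} (F : set_system X) {FF : Filter F} (w_ : X -> @data R d)
    (u_ : X -> C0_weakstar R n) w u : is_data false w -> data_map w u ->
  (\forall x \near F, is_data false (w_ x) /\ data_map (w_ x) (u_ x)) ->
  (forall j, w_ x j @[x --> F] --> w j) -> u_ @ F --> u.
Proof.
move=> dw wu D ww; apply: C0_cvg => t i.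
apply/(@cvgrPdist_lt _ _ _ (filter_prod (nbhs t) F) _ 
  (fun p => pairing (at_time (u_ p.2) p.1) i)).
apply: (pairing_cvg delta0 (w_ := fun p : R * X => w_ p.2) (t_ := fst) dw (wu t)).
- exists (setT, [set x | is_data false (w_ x) /\ data_map (w_ x) (u_ x)]).
    by split => //; exact: filterT.
  by move=> [s x] /= [_ [dx ux]]; split => //; exact: ux.
- exact: cvg_fst.
- move=> j; apply: cvg_comp (ww j); exact: cvg_snd.
Qed.

Lemma solutions_data_map exact u : 
  T_image (solutions_in alpha delta (target exact)) u <->
  exists2 w, is_data exact w & data_map w u.
Proof.
split=> [[U /(solution_data delta0)[w dw wU] uU]|[w dw wu]].
  exists w => // t i; apply: aeS2 (wU t) (uU t i) => s H E.
  by rewrite /at_time E.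
have [U sU wU] := data_solution delta0 dw; exists U => // t i.
apply: aeS2 (wu t i) (wU t) => s h1 h2; exact: has_deriv_unique h1 (h2 i).
Qed.

(** Pairings with indicators of intervals separate points: they determine the primitives of each
    component, hence the component almost everywhere. *)
Lemma C0_hausdorff : hausdorff_space (C0_weakstar R n).
Proof.
move=> u v uv.
have E t i : pairing (at_time u t) i = pairing (at_time v t) i.
  apply: (@norm_hausdorff R R^o) => A B Au Bv.
  have := uv _ _ (@C0_eval R n t i u A Au) (@C0_eval R n t i v B Bv).
  by move=> [x [xA xB]]; exists (pairing (at_time x t) i).
apply: C0_eq => t i.
have [Mu uM] := Linfty_bounded (at_time u t i).
have [Mv vM] := Linfty_bounded (at_time v t i).
pose K := Num.max 0 (Num.max Mu Mv).
have K0 : 0 <= K by rewrite le_max lexx.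
(* Elements of [Linfty] are bounded only almost everywhere, whereas [primitive_exists] asks for a
   bound at every point. *)
pose c (f : R -> R) s := clamp (- K) K (f s).
have cK (f : Linfty R) M : (\forall s \ae mu, `|f s| <= M) -> M <= K ->
    exists F, [/\ F 0 = 0, slopes (- K) K F,
    forall x y, x <= y -> F y - F x = \int[mu]_s (f s * \1_(`]x, y]%classic : set R) s)
    & \forall x \ae mu, has_deriv F x (f x)].
  move=> fM MK.
  have [|F [F0 sF FE dF]] := primitive_exists (u := c f) (L := K)
      (measurable_clamp (- K) K (Linfty_measurable f)).
    by move=> s; rewrite ler_norml clamp_in// (le_trans _ K0)// oppr_le0.
  have cf : \forall s \ae mu, c f s = f s.
    by apply: aeS fM => s fs; rewrite /c clampK// -ler_norml (le_trans fs).
  exists F; split => //.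
    move=> x y xy; rewrite Rintegral_mul_indic; last exact: measurable_itv.
    rewrite FE//; rewrite /Rintegral; congr fine; apply: ae_eq_integral => //.
    - by apply/measurable_EFinP/measurable_funTS; exact: measurable_clamp (Linfty_measurable f).
    - by apply/measurable_EFinP/measurable_funTS; exact: Linfty_measurable.
    - by apply: aeS cf => s + _ => ->.
  by apply: aeS2 dF cf => s dFs <-.
have [|F [F0 sF FE dF]] := cK _ _ uM; first by rewrite !le_max lexx orbT.
have [|G [G0 sG GE dG]] := cK _ _ vM; first by rewrite !le_max lexx !orbT.
suff FG : F = G.
  by rewrite FG in dF; apply: aeS2 dF dG => s; exact: has_deriv_unique.
have FGE x y : x <= y -> F y - F x = G y - G x.
  move=> xy; rewrite FE// GE//; have [g gE] := L1_indic x y.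
  by have := E t (i, g); rewrite /pairing/= gE.
apply/funext => x; have [x0|/ltW x0] := leP 0 x.
  by have := FGE _ _ x0; rewrite F0 G0 !subr0.
by have := FGE _ _ x0; rewrite F0 G0 !sub0r => /oppr_inj.
Qed.

Definition data_set : set (@data R d) := [set w | is_data false w].

Lemma data_eval (j : bool * 'I_d.+1 * R) : continuous (fun w : @data R d => w j).
Proof. exact: (@proj_continuous _ (fun=> R) j). Qed.

Lemma closure_ge0 (phi : @data R d -> R) (A : set (@data R d)) w : continuous phi ->
  (forall w, A w -> 0 <= phi w) -> closure A w -> 0 <= phi w.
Proof.
move=> cphi A0 Aw; rewrite leNgt; apply/negP => w0.
have : nbhs w (phi @^-1` [set x | x < 0]).
  by apply: cphi; apply: open_nbhs_nbhs; split; [exact: open_lt|].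
by move=> /Aw[w' [/A0]] /= h1 h2; have := le_lt_trans h1 h2; rewrite ltxx.
Qed.

(** In the form [is_data_incr], each condition is an inequality between continuous functions of
    finitely many values of [w], so it passes to the closure. *)
Lemma data_set_closed : closed data_set.
Proof.
move=> w clw; apply/is_data_incrP.
have D (phi : @data R d -> R) : continuous phi ->
    (forall w, is_data_incr alpha delta w -> 0 <= phi w) -> 0 <= phi w.
  move=> cphi H; apply: closure_ge0 cphi _ clw => w' /is_data_incrP; exact: H.
have ev c o y : continuous (fun w : @data R d => prim w c o y) by exact: data_eval.
have evN c o y : continuous (fun w : @data R d => - prim w c o y).
  by move=> w'; have h := cvgN (ev c o y w'); exact: h.
have evB c o x y : continuous (fun w : @data R d => prim w c o y - prim w c o x).
  by move=> w'; have h := cvgB (ev c o y w') (ev c o x w'); exact: h.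
split.
- move=> c o; apply/eqP; rewrite eq_le -oppr_ge0; apply/andP; split.
    by apply: (D (fun w => - prim w c o 0)) => // w' [-> _ _]; rewrite oppr0.
  by apply: (D (fun w => prim w c o 0)) => // w' [-> _ _].
- move=> c x y xy; apply/andP; split; rewrite -subr_ge0.
    apply: (D (fun w => prim w c ord0 y - prim w c ord0 x - _)).
      by move=> w'; have h := cvgB (evB c ord0 x y w') (cvg_cst _); exact: h.
    by move=> w' [_ h _]; rewrite subr_ge0; have /andP[] := h c x y xy.
  apply: (D (fun w => _ - (prim w c ord0 y - prim w c ord0 x))).
    by move=> w'; have h := cvgB (cvg_cst _) (evB c ord0 x y w'); exact: h.
  by move=> w' [_ h _]; rewrite subr_ge0; have /andP[] := h c x y xy.
- move=> c x y xy; rewrite -subr_ge0.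
  apply: (D (fun w => _ - \sum_o (prim w c o y - prim w c o x) ^+ 2)).
    suff cS : continuous (fun w : @data R d => \sum_o (prim w c o y - prim w c o x) ^+ 2).
      by move=> w'; have h := cvgB (cvg_cst _) (cS w'); exact: h.
    elim: (index_enum _) => [|o r IH].
      have -> : (fun w : @data R d => \sum_(o <- [::]) (prim w c o y - prim w c o x) ^+ 2) = cst 0.
        by apply/funext => w'; rewrite big_nil.
      exact: cst_continuous.
    have -> : (fun w : @data R d => \sum_(o <- o :: r) (prim w c o y - prim w c o x) ^+ 2) =
        fun w => (prim w c o y - prim w c o x) ^+ 2 + \sum_(o <- r) (prim w c o y - prim w c o x) ^+ 2.
      by apply/funext => w'; rewrite big_cons.
    move=> w'; have h := cvgD (cvgM (evB c o x y w') (evB c o x y w')) (IH w').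
    exact: h.
  by move=> w' [_ _ h]; rewrite subr_ge0; exact: h.
Qed.

Lemma data_set_compact : compact data_set.
Proof.
(* The radius at [y] is [|y|] because primitives vanish at 0 and are 1-Lipschitz. *)
pose box (j : bool * 'I_d.+1 * R) : set R := `[- `|j.2|, `|j.2|]%classic.
have cb : compact [set w : @data R d | forall j, box j (w j)].
  by apply: tychonoff => j; exact: segment_compact.
apply: (subclosed_compact data_set_closed cb) => w [w0 sw _] [[c o] y].
rewrite /box /= in_itv/= -ler_norml.
by have := slopes_lip (sw c o) y 0; rewrite -/(prim w c o 0) w0 !subr0 mul1r.
Qed.

Lemma T_image_compact : compact (T_image (solutions_in alpha delta (CM R d))).
Proof.
(* [Phi] below is total, so it needs a default value, taken from some datum; if there is none, the
   image is empty. *)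
have [[w0 dw0]|none] := pselect (exists w, is_data false w); last first.
  suff -> : T_image (solutions_in alpha delta (CM R d)) = set0 by exact: compact0.
  apply/seteqP; split => // u /(solutions_data_map false)[w dw _].
  by apply: none; exists w.
have [u0 _] := data_map_exists dw0.
have /choice[Phi PhiE] w : exists u, is_data false w -> data_map w u.
  have [dw|nw] := pselect (is_data false w); last by exists u0.
  by have [u wu] := data_map_exists dw; exists u.
have -> : T_image (solutions_in alpha delta (CM R d)) = Phi @` data_set.
  apply/seteqP; split => u.
    move=> /(solutions_data_map false)[w dw wu]; exists w => //.
    by apply: data_map_fun wu; exact: PhiE.
  by move=> [w dw <-]; apply/(solutions_data_map false); exists w => //; exact: PhiE.
apply: continuous_compact data_set_compact.
apply/subspace_continuousP => w dw.
apply: (data_map_cvg (w_ := id) dw (PhiE _ dw)).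
- by apply: filterS (withinT _ _) => w' dw'; split => //; exact: PhiE.
- by move=> j; apply: cvg_within_filter; exact: data_eval.
Qed.

Lemma closure_T_image : (0 < d)%N ->
  closure (T_image (Sigma R d alpha delta)) = T_image (solutions_in alpha delta (CM R d)).
Proof.
move=> d0; apply/seteqP; split.
  have := compact_closed C0_hausdorff T_image_compact.
  move=> /closure_id ->; apply: closure_subset => u.
  move=> /(solutions_data_map true)[w dw wu].
  by apply/(solutions_data_map false); exists w => //; exact: is_data_closed.
move=> u /(solutions_data_map false)[w dw wu].
have [w_ [dw_ ww]] := data_approx d0 dw.
have dw_' m : is_data false (w_ m) by apply: is_data_closed.
have /choice[u_ wu_] m := data_map_exists (dw_' m).
have uu : u_ @ \oo --> u.
  apply: (data_map_cvg (w_ := w_) dw wu) => //; exact: nearW.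
move=> A /uu [N _ NA]; exists (u_ N); split; last by apply: NA => /=.
by apply/(solutions_data_map true); exists (w_ N).
Qed.

End solution_map.

(** The first clause ensures that [T_image] loses no solution: one without a representative in
    [C0_weakstar] would be absent from the image. *)
Theorem theorem4p1 (R : realType) (d : nat) (alpha delta : R) :
  (1 <= d)%N -> 0 < delta -> delta < 1 ->
  [/\ forall U : R -> R -> state R d,
        (Sigma R d alpha delta `|` solutions_in alpha delta (CM R d)) U ->
        exists u : C0_weakstar R (1 + 1 + d + d),
          represents u (fun t s => T (U t s)),
      compact (closure (T_image (Sigma R d alpha delta))) &
      closure (T_image (Sigma R d alpha delta))
        = T_image (solutions_in alpha delta (CM R d))].
Proof.
move=> d0 delta0 _; split; last exact: closure_T_image.
  move=> U UE.
  have [w dw wU] : exists2 w, is_data alpha delta false w & forall t,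
      \forall s \ae (@lebesgue_measure R), forall i,
      has_deriv (fun s => pot w t s 0 i) s (T (U t s) 0 i).
    case: UE => UE; last exact: (@solution_data _ _ _ _ delta0 false).
    have [w dw wU] := (@solution_data _ _ _ _ delta0 true U UE).
    by exists w => //; exact: is_data_closed.
  have [u wu] := data_map_exists delta0 dw; exists u => t i.
  by apply: aeS2 (wu t i) (wU t) => s h1 h2; exact: has_deriv_unique h1 (h2 i).
by rewrite closure_T_image//; exact: T_image_compact.
Qed.
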